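(* Let $$f\colon \mathbb{A}^3_{\mathbb{Q}} \longrightarrow \mathbb{A}^3_{\mathbb{Q}},\qquad (x,y,z)\mapsto (y,\; x+y-y^3,\; 2z-y).$$ Then the following statements hold. (1) For any $n\ge 1$, the set of $n$-periodic points of $f$, i.e. $\{P\in\mathbb{A}^3(\overline{\mathbb{Q}})\mid f^n(P)=P\}$, is finite. (2) The set of periodic points $\{P\in \mathbb{A}^3(\overline{\mathbb{Q}})\mid f^n(P)=P \text{ for some } n\ge 1\}$ is height unbounded (that is, not height bounded).
   Context: Height bounded: let $X$ be a quasi-projective variety over $\overline{\mathbb{Q}}$. A subset $S\subset X(\overline{\mathbb{Q}})$ is height bounded if for an open immersion $i\colon X\hookrightarrow P$ into a projective variety $P$ and a (logarithmic) Weil height function $h_H$ associated with an ample divisor $H$ on $P$, the function $h_H\circ i$ is bounded on $S$. This is independent of the choice of $i$, $H$, $h_H$; for $\mathbb{A}^3$ one may take the standard embedding $\mathbb{A}^3\subset\mathbb{P}^3$ and the naive logarithmic height on $\mathbb{P}^3(\overline{\mathbb{Q}})$. *)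

(* Defs.v *)
From HB Require Import structures.
From mathcomp Require Import all_boot all_order all_algebra all_field.
From mathcomp Require Import finmap complex.
From mathcomp Require Import all_classical all_reals all_analysis.

Set Implicit Arguments.
Unset Strict Implicit.
Unset Printing Implicit Defensive.

Import Order.TTheory GRing.Theory Num.Theory.

Local Open Scope classical_set_scope.
Local Open Scope ring_scope.

(* A finite place of a number field K (K : fieldExtType rat) is a nonzero prime
   of its ring of integers, given here by its normalised valuation.  The
   conventional value +oo at 0 is replaced by the junk value 0, so that a place
   is represented by exactly one function. *)
Definition finite_place (K : fieldType) : set (K -> int) :=
  [set v | [/\ v 0 = 0,
               forall x y, x != 0 -> y != 0 -> v (x * y) = v x + v y,
               forall x y, x != 0 -> y != 0 -> x + y != 0 ->
                 Num.min (v x) (v y) <= v (x + y)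
             & exists2 x, x != 0 & v x = 1]].

Definition valuation_ring (K : fieldType) (v : K -> int) : set K :=
  [set x | x != 0 -> 0 <= v x].

Definition valuation_ideal (K : fieldType) (v : K -> int) : set K :=
  [set x | x != 0 -> 0 < v x].

(* Cosets of the maximal ideal in the valuation ring.  This is a finite set
   when K is a number field and v is a finite place. *)
Definition residue_field (K : fieldType) (v : K -> int) : set (set K) :=
  [set [set b | valuation_ideal v (b - a)] | a in valuation_ring v].

Definition place_norm (K : fieldType) (v : K -> int) : nat :=
  #|` fset_set (residue_field v)|.

(* The normalised absolute value N(v)^(- v x).  As N(v) = p ^ f(v), and v is
   e(v) times the extension of the p-adic valuation, this is
   |x|_v ^ [K_v : Q_p], where |p|_v = 1/p. *)
Definition finite_absv (R : realType) (K : fieldType) (v : K -> int) (x : K) : R :=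
  if x == 0 then 0 else (place_norm v)%:R ^ (- v x).

(* Functions rather than {rmorphism K -> R[i]}, whose elements may differ by
   the proofs they contain. *)
Definition complex_embedding (R : realType) (K : fieldType) : set (K -> R[i]) :=
  [set s : K -> R[i] | exists g : {rmorphism K -> R[i]}, s = g].

(* Logarithmic height of the point [u_0 : ... : u_n] of P^n(K), relative to K
   and then divided by [K : Q].  A complex place contributes through its two
   conjugate embeddings, which accounts for its local degree.  For u <> 0 only
   finitely many terms are nonzero (otherwise \sum_(_ \in _) would be 0). *)
Definition number_field_height (R : realType) (K : fieldExtType rat) (n : nat)
    (u : 'rV[K]_n.+1) : R :=
  ((\dim {:K})%:R)^-1 *
  (\sum_(s \in @complex_embedding R K)
      ln (\big[Num.max/0]_(i < n.+1) ComplexField.Normc.normc (s (u 0 i)))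
   + \sum_(v \in @finite_place K)
      ln (\big[Num.max/0]_(i < n.+1) finite_absv R v (u 0 i))).

(* Naive absolute logarithmic height on P^n(Qbar) in homogeneous coordinates,
   with Qbar = algC, computed in the number field generated by the coordinates
   that num_field_exists provides. *)
Definition height (R : realType) (n : nat) (x : 'rV[algC]_n.+1) : R :=
  let: existT K (existT _ (exist2 u _ _)) :=
    num_field_exists [seq x 0 i | i <- enum 'I_n.+1] in
  @number_field_height R K n (\row_(i < n.+1) u`_i).

(* (x_1, ..., x_n) |-> [1 : x_1 : ... : x_n] *)
Definition affine_to_proj (n : nat) (P : 'rV[algC]_n) : 'rV[algC]_n.+1 :=
  row_mx (const_mx 1 : 'rV[algC]_1) P.

Definition height_bounded (R : realType) (n : nat) (S : set 'rV[algC]_n) : Prop :=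
  exists M : R, forall P, S P -> `|height R (affine_to_proj P)| <= M.

Definition f (P : 'rV[algC]_3) : 'rV[algC]_3 :=
  let x := P 0 0 in let y := P 0 1 in let z := P 0 2%:R in
  \row_(i < 3) [:: y; x + y - y ^+ 3; 2%:R * z - y]`_i.

(* Main.v *)
(* (1) Along an n-periodic orbit the first coordinates satisfy y_i^3 = y_{i-1} + y_i - y_{i+1}
   cyclically, so every y_i is an eigenvalue of a matrix that depends on n only; the third
   coordinate is determined by (2^n - 1) z = sum of 2^(n-i) y_i.

   (2) Take m = 2 * 3^k and n = 2m, so that 3^(k+1) divides 2^n - 1.  Let y_0 = 0, y_1 = t and
   y_{i+2} = y_i + y_{i+1} - y_{i+1}^3, a polynomial in t.  If y_m(t) = 0, then the reflection
   y_{m+j} = (-1)^(j+1) y_{m-j} makes the orbit n-periodic, and z = H(t) / (2^n - 1) with H of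
   degree 3^(m-2), whereas y_m has degree 3^(m-1).  Modulo 3 the polynomial y_m is separable,
   so some irreducible factor g of y_m over Q has at most a third of its roots mod 3 in common
   with H.  For a root t of g the prime 3 is unramified in Q(t), the places above it correspond
   to the irreducible factors of g mod 3, and at two thirds of them, counted with degree, H(t)
   is a unit.  There z has a pole of order at least k + 1, hence the height of the point is at
   least (2/3) (k + 1) log 3. *)

Require Import Defs.
From HB Require Import structures.
From mathcomp Require Import all_boot all_order all_algebra all_field.
From mathcomp Require Import complex finmap.
From mathcomp Require Import all_classical all_reals all_analysis.
From mathcomp Require Import zify ring.

Set Implicit Arguments.
Unset Strict Implicit.
Unset Printing Implicit Defensive.

Import Order.TTheory GRing.Theory Num.Theory.

Local Open Scope classical_set_scope.
Local Open Scope ring_scope.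

(** * Finite places and weak approximation *)

Section FinitePlaces.
Variable K : fieldType.
Implicit Types (v w : K -> int) (x y : K).

(** Stands for [v x >= k] under the usual convention that the valuation of 0 is infinite, which the
    junk value [v 0 = 0] would break. *)
Definition val_ge v (k : int) x := (x != 0) ==> (k <= v x).

Section OnePlace.
Variable v : K -> int.
Hypothesis vP : finite_place v.

Lemma place0 : v 0 = 0. Proof. by case: vP. Qed.

Lemma placeM x y : x != 0 -> y != 0 -> v (x * y) = v x + v y.
Proof. by case: vP => _ vM _ _; exact: vM. Qed.

Lemma place1 : v 1 = 0.
Proof.
have /eqP := placeM (oner_neq0 K) (oner_neq0 K).
by rewrite mulr1 -[X in X == _]addr0 (inj_eq (addrI _)) eq_sym => /eqP.
Qed.

Lemma placeV x : v x^-1 = - v x.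
Proof.
have [->|x0] := eqVneq x 0; first by rewrite invr0 place0 oppr0.
have := placeM x0 (invr_neq0 x0); rewrite divff // place1 => h.
by apply/eqP; rewrite -addr_eq0 addrC -h.
Qed.

Lemma placeX x n : x != 0 -> v (x ^+ n) = v x *+ n.
Proof.
move=> x0; elim: n => [|n IH]; first by rewrite expr0 mulr0n place1.
by rewrite exprS placeM ?expf_neq0 // IH mulrS.
Qed.

Lemma placeN x : v (- x) = v x.
Proof.
have h : v (-1) = 0.
  have := placeX 2 (_ : (-1 : K) != 0).
  by rewrite sqrrN expr1n place1 oppr_eq0 oner_neq0 => /(_ isT); lia.
have [->|x0] := eqVneq x 0; first by rewrite oppr0.
by rewrite -mulN1r placeM ?oppr_eq0 ?oner_neq0 // h add0r.
Qed.

Lemma val_geD k x y : val_ge v k x -> val_ge v k y -> val_ge v k (x + y).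
Proof.
rewrite /val_ge; have [->|x0] := eqVneq x 0; first by rewrite add0r.
have [->|y0] := eqVneq y 0; first by rewrite addr0 x0.
move=> /= hx hy; apply/implyP => xy0; case: vP => _ _ /(_ x y x0 y0 xy0) h _.
by apply: le_trans h; rewrite le_min hx.
Qed.

Lemma val_geN k x : val_ge v k (- x) = val_ge v k x.
Proof. by rewrite /val_ge oppr_eq0 placeN. Qed.

Lemma val_geM k l x y : val_ge v k x -> val_ge v l y -> val_ge v (k + l) (x * y).
Proof.
rewrite /val_ge mulf_eq0 negb_or => hx hy; apply/implyP => /andP[x0 y0].
by rewrite placeM // lerD // (implyP hx, implyP hy).
Qed.

Lemma val_ge0 k : val_ge v k 0. Proof. by rewrite /val_ge eqxx. Qed.

Lemma val_ge_sum (I : Type) (r : seq I) (P : pred I) (F : I -> K) k :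
  (forall i, P i -> val_ge v k (F i)) -> val_ge v k (\sum_(i <- r | P i) F i).
Proof.
move=> h; apply: (big_ind (val_ge v k)) => //; first exact: val_ge0.
by move=> x y; apply: val_geD.
Qed.

(** The ultrametric inequality for [x + y] gives one bound; applied to [x = (x + y) - y] it gives
    the other. *)
Lemma placeD_lt x y : x != 0 -> val_ge v (v x + 1) y ->
  x + y != 0 /\ v (x + y) = v x.
Proof.
move=> x0 hy; have [y0|y0] := eqVneq y 0; first by rewrite y0 addr0.
have {}hy : v x < v y by move: hy; rewrite /val_ge y0 /=; lia.
have xy0 : x + y != 0.
  apply/negP; rewrite addrC addr_eq0 => /eqP yx.
  by move: hy; rewrite yx placeN ltxx.
split=> //; case: vP => _ _ vD _.
have h1 := vD _ _ x0 y0 xy0.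
have yN0 : - y != 0 by rewrite oppr_eq0.
have h2 := vD (x + y) (- y) xy0 yN0; rewrite addrK placeN in h2.
have {}h2 := h2 x0.
move: h1 h2 hy; rewrite !ge_min => /orP h1 /orP h2 h3; move: (v (x + y)) (v x) (v y) h1 h2 h3 => a b c; lia.
Qed.

Lemma val_ge_nat n : val_ge v 0 n%:R.
Proof.
elim: n => [|n IH]; first exact: val_ge0.
rewrite -natr1; apply: val_geD => //.
by rewrite /val_ge place1 implybT.
Qed.

Lemma val_ge_int (z : int) : val_ge v 0 z%:~R.
Proof.
by case: z => n; rewrite ?NegzE ?mulrNz ?val_geN; exact: val_ge_nat.
Qed.

Lemma place_neg_neq0 x : v x != 0 -> x != 0.
Proof. by apply: contraNneq => ->; rewrite place0. Qed.

End OnePlace.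

(** Otherwise the valuation ring of [v] lies in that of [w], so units at [v] are units at [w].
    Dividing [x] by the power [v x] of a uniformiser [p] of [v] then gives [w x = v x * w p], and
    since [w] also takes the value 1, [w p = 1]. *)
Lemma places_separated v w : finite_place v -> finite_place w -> v <> w ->
  exists2 x, 0 <= v x & w x < 0.
Proof.
move=> vP wP vw; apply: contrapT => h.
have {}h x : 0 <= v x -> 0 <= w x.
  by move=> vx; rewrite leNgt; apply/negP => wx; apply: h; exists x.
have h0 x : v x = 0 -> w x = 0.
  move=> vx; apply/eqP; rewrite eq_le (h x) ?vx // andbT -oppr_ge0 -placeV //.
  by rewrite h // placeV // vx oppr0.
case: (vP) => _ _ _ [p p0 vp].
have wE x : x != 0 -> w x = v x * w p.
  move=> x0.
  have pz z : p ^ z != 0 by rewrite expfz_neq0.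
  have vz z : v (p ^ z) = z.
    case: z => n; rewrite ?NegzE -?exprnN -?exprnP ?placeV // placeX // vp.
      by rewrite pmulrn intz.
    by rewrite pmulrn intz.
  have wz z : w (p ^ z) = z * w p.
    case: z => n; rewrite ?NegzE -?exprnN -?exprnP ?placeV // placeX //.
      by rewrite -mulr_natl natz.
    by rewrite -mulr_natl natz mulNr.
  have := h0 (x * p ^ (- v x)).
  rewrite !placeM // vz subrr => /(_ erefl); rewrite wz mulNr.
  by move/eqP; rewrite subr_eq0 => /eqP.
have wp : w p = 1.
  have wp0 : 0 <= w p by apply: h; rewrite vp.
  case: (wP) => _ _ _ [q q0]; rewrite wE // => h1.
  move: (v q) (w p) h1 wp0 => a b h1 b0; have [a0|a1] : a <= 0 \/ 1 <= a by lia.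
    nia.
  by have [b1|b2] : b <= 1 \/ 2 <= b; [lia|nia|nia].
apply: vw; apply/funext => x; have [->|x0] := eqVneq x 0.
  by rewrite !place0.
by rewrite wE // wp mulr1.
Qed.

Lemma places_opposite v w : finite_place v -> finite_place w -> v <> w ->
  exists x, v x < 0 /\ 0 < w x.
Proof.
move=> vP wP vw.
have [x vx wx] := places_separated vP wP vw.
have [y wy vy] := places_separated wP vP (nesym vw).
have x0 : x != 0 by apply: (place_neg_neq0 wP); lia.
have y0 : y != 0 by apply: (place_neg_neq0 vP); lia.
exists (y / x); rewrite !placeM ?invr_eq0 // !placeV //; lia.
Qed.

(* Artin-Whaples induction: [x ^+ N / (1 + x ^+ N)] is close to 1 at the places
   where [x] has a pole and close to 0 at those where [x] vanishes. *)
Lemma place_isolated v (s : seq (K -> int)) :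
  finite_place v -> (forall w, w \in s -> finite_place w /\ v <> w) ->
  exists x, v x < 0 /\ forall w, w \in s -> 0 < w x.
Proof.
move=> vP; elim: s => [|w s IH] sP.
  case: (vP) => _ _ _ [p p0 vp]; exists p^-1; split=> //.
  by rewrite placeV // vp.
have [|x [vx sx]] := IH; first by move=> u us; apply: sP; rewrite inE us orbT.
have [wP vw] := sP w (mem_head _ _).
have {}sP u : u \in s -> finite_place u.
  by move=> us; case: (sP u) => //; rewrite inE us orbT.
have [y [vy wy]] := places_opposite vP wP vw.
have x0 : x != 0 by apply: (place_neg_neq0 vP); lia.
have y0 : y != 0 by apply: (place_neg_neq0 vP); lia.
(* [N] is so large that the zeros of [x ^+ N] outweigh any pole of [y] on [s]. *)
have [N N0 sN] : exists2 N : nat, (0 < N)%N & forall u, u \in s -> 0 < u x *+ N + u y.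
  exists (\max_(u <- s) `|u y|%N).+1 => // u us.
  have := sx u us; have : (`|u y| <= \max_(u <- s) `|u y|)%N.
    exact: (@leq_bigmax_seq _ s xpredT (fun u : K -> int => `|u y|%N) u us).
  set M := \max_(_ <- _) _; rewrite -mulr_natl; nia.
have xN0 : x ^+ N != 0 by rewrite expf_neq0.
(* Three cases: [x] itself works if [w x > 0], and [x ^+ N * y] if [w x = 0]. If [x] has a pole at
   [w], then [x ^+ N / (1 + x ^+ N)] replaces [x ^+ N]: it is a unit at [v] and [w] and has the
   valuation of [x ^+ N] on [s]. *)
case: (ltP (w x) 0) => wx; last first.
  have [wx1|wx1] := ltP 0 (w x).
    by exists x; split=> // u; rewrite inE => /orP[/eqP->//|]; exact: sx.
  exists (x ^+ N * y); split.
    by rewrite placeM // placeX // -mulr_natl; nia.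
  move=> u; rewrite inE => /orP[/eqP->|us].
    by rewrite placeM // placeX // -mulr_natl; nia.
  by rewrite placeM ?placeX //; [exact: sN|exact: sP|exact: sP].
have pole u : finite_place u -> u x < 0 ->
    1 + x ^+ N != 0 /\ u (1 + x ^+ N) = u x *+ N.
  move=> uP ux; rewrite addrC -(placeX uP) //; apply: placeD_lt => //.
  by rewrite /val_ge place1 // placeX // -mulr_natl; apply/implyP => _; nia.
have [d0 vd] := pole v vP vx.
have [_ wd] := pole w wP wx.
have dV0 : (1 + x ^+ N)^-1 != 0 by rewrite invr_neq0.
exists (x ^+ N / (1 + x ^+ N) * y); split.
  by rewrite !placeM ?mulf_neq0 // placeV // vd placeX // addrN add0r.
move=> u; rewrite inE => /orP[/eqP->|us].
  by rewrite !placeM ?mulf_neq0 // placeV // wd placeX // addrN add0r.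
have uP := sP u us; rewrite !placeM ?mulf_neq0 // placeV // placeX //.
suff [_ ->] : 1 + x ^+ N != 0 /\ u (1 + x ^+ N) = u 1.
  by rewrite place1 // subr0; exact: sN.
apply: placeD_lt => //; first exact: oner_neq0.
rewrite /val_ge place1 // add0r placeX // -mulr_natl; apply/implyP => _.
by have := sx u us; nia.
Qed.

(** With [x] from [place_isolated], [x / (1 + x)] is a unit at the pole [v] of [x] and has the same
    zeros as [x] on [s]. *)
Lemma place_peak v (s : seq (K -> int)) :
  finite_place v -> (forall w, w \in s -> finite_place w /\ v <> w) ->
  exists x, [/\ x != 0, v x = 0 & forall w, w \in s -> 0 < w x].
Proof.
move=> vP sP; have [x [vx sx]] := place_isolated vP sP.
have x0 : x != 0 by apply: (place_neg_neq0 vP); lia.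
have [d0 vd] : 1 + x != 0 /\ v (1 + x) = v x.
  rewrite addrC; apply: placeD_lt => //.
  by rewrite /val_ge place1 //; apply/implyP => _; lia.
exists (x / (1 + x)); rewrite mulf_neq0 ?invr_eq0 // placeM ?invr_eq0 //.
rewrite placeV // vd subrr; split=> // w ws; have [wP _] := sP w ws.
rewrite placeM ?invr_eq0 // placeV //.
suff [_ ->] : 1 + x != 0 /\ w (1 + x) = w 1.
  by rewrite place1 // subr0; exact: sx.
apply: placeD_lt => //; first exact: oner_neq0.
by rewrite /val_ge place1 //; apply/implyP => _; have := sx w ws; lia.
Qed.

End FinitePlaces.

(** In a Bezout relation [1 = a p + b c] the right side would have positive valuation if [v c] were
    positive. *)
Lemma place_int_coprime (K : fieldType) (v : K -> int) (p : nat) (c : int) :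
  finite_place v -> val_ge v 1 p%:R -> coprimez p c -> c%:~R != 0 :> K /\ v c%:~R = 0.
Proof.
move=> vP vp /coprimezP[[a b] /= abE].
have E : 1 = a%:~R * p%:R + b%:~R * c%:~R :> K.
  by have := congr1 (fun z : int => z%:~R : K) abE; rewrite intrD !intrM => /esym.
have h : ~~ val_ge v 1 (c%:~R : K).
  apply/negP => vc.
  have := val_ge_int vP a; have := val_ge_int vP b => hb ha.
  have := val_geD vP (val_geM vP ha vp) (val_geM vP hb vc).
  by rewrite -E add0r /val_ge oner_neq0 place1.
move: h; rewrite /val_ge negb_imply => /andP[c0 h]; split=> //.
by have := val_ge_int vP c; rewrite /val_ge c0 /=; move: (v _) h => z; lia.
Qed.

(** Elements that are units at their own place and vanish at the other places of [s] are linearly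
    independent over Q. A relation may be taken with primitive integer coefficients; one of them is
    prime to [p], and at the corresponding place its term is the only one of valuation 0. *)
Lemma size_places_over (K : fieldExtType rat) (p : nat) (s : seq (K -> int)) :
  prime p -> uniq s -> (forall v, v \in s -> finite_place v /\ 0 < v p%:R) ->
  (size s <= \dim {:K})%N.
Proof.
move=> p_pr s_uniq sP.
have /choice[x xP] : forall v, exists x : K, v \in s ->
    [/\ x != 0, v x = 0 & forall w, w \in s -> v <> w -> 0 < w x].
  move=> v; have [vs|] := boolP (v \in s); last by exists 0.
  have [|x [x0 vx wx]] := @place_peak _ v (rem v s) (sP v vs).1.
    move=> w; rewrite mem_rem_uniq // inE => /andP[/eqP wv ws].
    by split; [exact: (sP w ws).1|exact: nesym].
  exists x => _; split=> // w ws vw; apply: wx.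
  by rewrite mem_rem_uniq // inE ws andbT; apply/eqP => /esym.
have sz : size (map x s) == size s by rewrite size_map.
suff : free (map x s).
  rewrite /free size_map => /eqP <-.
  by apply: dimvS; exact: subvf.
pose X := in_tuple (map x s).
suff : free X by [].
apply/freeP => k kX i0; apply/eqP/negPn/negP => ki0.
(* The coefficients of the relation are packed into a polynomial, so that [rat_poly_scale] and
   [zprimitive] clear denominators and common factors. *)
pose q := \poly_(i < size (map x s)) oapp k 0 (insub i).
have qE (i : 'I_(size (map x s))) : q`_i = k i.
  by rewrite coef_poly ltn_ord valK.
have [r [a a0 qr]] := rat_poly_scale q.
have r0 : r != 0.
  apply: contraNneq ki0 => r0.
  by rewrite -qE qr r0 rmorph0 scaler0 coef0.
pose c i := (zprimitive r)`_i.
have [i pci] : exists i : 'I_(size (map x s)), ~~ (p %| c i)%Z.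
  apply: contrapT => h.
  have : (p %| zcontents (zprimitive r))%Z.
    rewrite dvdz_contents; apply/polyOverP => i.
    have [lti|gei] := ltnP i (size (map x s)); last first.
      rewrite nth_default ?dvdz0 // ?size_zprimitive.
      have -> : size r = size q.
        by rewrite qr size_scale ?invr_eq0 ?intr_eq0 // size_map_inj_poly // ; exact: intr_inj.
      by apply: leq_trans (size_poly _ _) gei.
    by apply: contrapT => hi; apply: h; exists (Ordinal lti); apply/negP.
  by rewrite zcontents_primitive r0 dvdz1 /=; have := prime_gt1 p_pr; lia.
have cX : \sum_(j < size (map x s)) (c j)%:~R * X`_j = 0.
  have b0 : (zcontents r)%:~R / a%:~R != 0 :> rat.
    by rewrite mulf_neq0 ?invr_eq0 ?intr_eq0 ?zcontents_eq0.
  apply/(scalerI b0); rewrite scaler0 -[RHS]kX scaler_sumr; apply: eq_bigr => j _.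
  rewrite -qE qr coefZ coef_map /= [in RHS](zpolyEprim r) coefZ.
  rewrite -/(c j) (_ : (c j)%:~R * X`_j = (c j)%:~R *: X`_j); last first.
    by rewrite mulrzl scaler_int.
  by rewrite scalerA [_ / _]mulrC -mulrA -intrM.
have szs : size (map x s) = size s by rewrite size_map.
have lti : (i < size s)%N by rewrite -szs.
pose v := nth (fun _ => 0) s i.
have vs : v \in s by rewrite mem_nth.
have [vP vp] := sP v vs.
have Xj (j : 'I_(size (map x s))) : X`_j = x (nth (fun _ => 0) s j).
  by rewrite /X /= (nth_map (fun _ => 0)) // -szs.
have vp1 : val_ge v 1 p%:R by apply/implyP => _; move: vp; case: (v _).
have [|ci0 vci] := @place_int_coprime K v p (c i) vP vp1.
  by rewrite coprimezE /= prime_coprime // -dvdzE.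
have [xv0 vxv _] := xP v vs.
have t0 : (c i)%:~R * X`_i != 0 by rewrite mulf_neq0 // Xj.
have vt : v ((c i)%:~R * X`_i) = 0 by rewrite placeM // Xj // vci vxv.
move: cX; rewrite (bigD1 i) //=.
have [|] := @placeD_lt _ v vP _ (\sum_(j < size (map x s) | j != i) (c j)%:~R * X`_j) t0; last first.
- by move=> /eqP.
rewrite vt add0r; apply: val_ge_sum => // j ji.
rewrite -[1]add0r; apply: val_geM => //; first exact: val_ge_int.
apply/implyP => _; rewrite Xj.
have ltj : (j < size s)%N by rewrite -szs.
have ws : nth (fun _ => 0) s j \in s by rewrite mem_nth.
have [_ _ /(_ v vs)] := xP _ ws; apply.
move=> /eqP; rewrite nth_uniq // => /eqP ij.
by move/eqP: ji; apply; apply/val_inj.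
Qed.

(** Such a place is positive at some prime factor of [n], and above each prime there are at most
    [\dim {:K}] places. *)
Lemma finite_places_over (K : fieldExtType rat) (n : nat) : (0 < n)%N ->
  finite_set [set v : K -> int | finite_place v /\ 0 < v n%:R].
Proof.
move=> n0.
apply: (@sub_finite_set _ _
  (\bigcup_(p in [set p | p \in primes n]) [set v : K -> int | finite_place v /\ 0 < v p%:R])).
  move=> v [vP vn] /=.
  have nK m : (0 < m)%N -> m%:R != 0 :> K.
    move=> m0; rewrite -(rmorph_nat (in_alg K)) fmorph_eq0 pnatr_eq0; lia.
  apply: contrapT => h; move: vn.
  suff -> : v n%:R = 0 by [].
  rewrite [n in n%:R]prod_prime_decomp // big_seq.
  have [_ -> //] : (\prod_(f <- prime_decomp n | f \in prime_decomp n) f.1 ^ f.2)%:R != 0 :> K /\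
     v (\prod_(f <- prime_decomp n | f \in prime_decomp n) f.1 ^ f.2)%:R = 0.
  apply: (big_ind (fun m => m%:R != 0 :> K /\ v m%:R = 0)).
  - by rewrite oner_neq0 place1.
  - by move=> a b [a0 va] [b0 vb]; rewrite natrM mulf_neq0 // placeM // va vb.
  - move=> [p e] /mem_prime_decomp[p_pr e0 pn] /=.
    have p0 : p%:R != 0 :> K by rewrite nK // prime_gt0.
    rewrite natrX expf_neq0 // placeX //; split=> //.
    suff -> : v p%:R = 0 by rewrite mul0rn.
    have := val_ge_nat vP p; rewrite /val_ge p0 /= le_eqVlt => /orP[/eqP //|vp].
    exfalso; apply: h; exists p => //=.
    rewrite mem_primes p_pr n0 /=.
    by apply: dvdn_trans pn; rewrite -(prednK e0) expnS dvdn_mulr.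
apply: bigcup_finite => [|p /=]; first exact: finite_seq.
rewrite mem_primes => /and3P[p_pr _ _].
apply: contrapT => /(infinite_set_fset (\dim {:K}).+1)[B BP].
apply/negP; rewrite -ltnNge ltnS.
by apply: (@size_places_over K p) => [//||v vB]; [exact: fset_uniq|exact: BP].
Qed.

(** * Places attached to principal primes *)

Section PlaceOfPrime.
Variables (A : comNzRingType) (K : fieldType) (ev : {rmorphism A -> K}).
(** [m] is a prime ideal of [A] containing the kernel of [ev]. By [e_absorb], with [e] outside [m],
    the element [pi] generates it after localisation; [ev_norm] bounds how often [pi] can be divided
    out, so the localisation is a discrete valuation ring of [K]. *)
Variables (m : pred A) (pi e : A).
Hypothesis mD : forall a b, m a -> m b -> m (a + b).
Hypothesis mM : forall a b, m (a * b) = m a || m b.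
Hypothesis m1 : ~~ m 1.
Hypothesis m_ker : forall a, ev a = 0 -> m a.
Hypothesis m_pi : m pi.
Hypothesis ev_pi : ev pi != 0.
Hypothesis e_unit : ~~ m e.
Hypothesis e_absorb : forall a, m a -> exists b, ev (e * a) = ev (pi * b).
Hypothesis ev_frac : forall x, exists a b, ev b != 0 /\ x * ev b = ev a.
Hypothesis ev_norm : forall a, ev a != 0 ->
  exists b j c, ~~ m c /\ ev (a * b) = ev (pi ^+ j * c).

Let mN a : m a -> m (- a). Proof. by rewrite -mulN1r mM => ->; rewrite orbT. Qed.

Let mDl a b : m b -> m (a + b) = m a.
Proof.
move=> mb; apply/idP/idP => h; last exact: mD.
by rewrite -[a](addrK b) mD ?mN.
Qed.

Let munitX a n : ~~ m a -> ~~ m (a ^+ n).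
Proof.
move=> ma; elim: n => [|n IH]; first by rewrite expr0.
by rewrite exprS mM negb_or ma.
Qed.

Let piz (k : int) : ev pi ^ k != 0. Proof. exact: expfz_neq0. Qed.

Let unit_neq0 a : ~~ m a -> ev a != 0.
Proof. by apply: contraNneq => /m_ker. Qed.

(** The valuation starts as a relation, so that uniqueness and multiplicativity can be proved before
    existence. *)
Definition has_val x (k : int) := exists a s,
  [/\ ~~ m a, ~~ m s & x * ev s = ev pi ^ k * ev a].

(** If [k < l], comparing the two expressions for [x] shows that [a * s'] is a multiple of [pi] up
    to the kernel, hence lies in the prime, while neither factor does. *)
Lemma has_val_inj x k l : has_val x k -> has_val x l -> k = l.
Proof.
wlog kl : k l / k < l.
  move=> h hk hl; have [kl|lk|//] := ltgtP k l; first exact: h.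
  by apply/esym; exact: h.
move=> [a [s [ma ms xs]]] [a' [s' [ma' ms' xs']]]; exfalso.
have [n ln] : exists n : nat, l = k + n.+1 by exists (`|l - k|.-1)%N; lia.
have E : ev (a * s') = ev (pi * (pi ^+ n * a' * s)).
  apply: (mulfI (piz k)); rewrite !rmorphM; rewrite [LHS]mulrA -xs mulrAC xs' ln.
  rewrite expfzDr // -exprnP exprS rmorphXn /=; ring.
have : m (a * s' - pi * (pi ^+ n * a' * s)) by apply: m_ker; rewrite rmorphB E subrr.
by rewrite mDl ?mN ?mM ?m_pi // (negPf ma) (negPf ms').
Qed.

Lemma has_valM x y k l : has_val x k -> has_val y l -> has_val (x * y) (k + l).
Proof.
move=> [a [s [ma ms xs]]] [b [r [mb mr yr]]]; exists (a * b), (s * r).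
rewrite !mM !negb_or ma mb ms mr; split=> //.
by rewrite !rmorphM expfzDr // mulrACA xs yr mulrACA.
Qed.

Lemma has_valV x k : has_val x k -> has_val x^-1 (- k).
Proof.
move=> [a [s [ma ms xs]]]; exists s, a; split=> //.
have x0 : x != 0.
  apply/eqP => x0; move: xs; rewrite x0 mul0r => /esym/eqP.
  by rewrite mulf_eq0 (negPf (piz k)) (negPf (unit_neq0 ma)).
apply: (mulfI x0); rewrite mulrA divff // mul1r mulrCA xs mulrA -expfzDr //.
by rewrite addNr expr0z mul1r.
Qed.

Lemma has_val_unit a : ~~ m a -> has_val (ev a) 0.
Proof. by move=> ma; exists a, 1; rewrite rmorph1 mulr1 expr0z mul1r. Qed.

Lemma has_val_pi : has_val (ev pi) 1.
Proof. by exists 1, 1; rewrite rmorph1 expr1z. Qed.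

(* As long as the numerator lies in the prime, [e] allows one more division by
   [pi]; [ev_norm] stops this. *)
Lemma has_val_ev a : ev a != 0 -> exists2 k : nat, has_val (ev a) k & m a -> (0 < k)%N.
Proof.
move=> a0; have [b [j [c [mc abE]]]] := ev_norm a0.
have step i : (exists2 k : nat, has_val (ev a) k & m a -> (0 < k)%N) \/
    exists a', ev (e ^+ i * a) = ev (pi ^+ i * a').
  elim: i => [|i [|[a' E]]]; [by right; exists a; rewrite !expr0 | by left | ].
  have [ma'|ma'] := boolP (m a').
    right; have [b' E'] := e_absorb ma'; exists b'.
    have -> : ev (e ^+ i.+1 * a) = ev (pi ^+ i) * ev (e * a').
      by rewrite exprS -mulrA rmorphM E !rmorphM mulrCA.
    by rewrite E' -rmorphM mulrA -exprSr.
  left; exists i; first exists a', (e ^+ i).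
    by rewrite munitX // ma'; split=> //; rewrite mulrC -rmorphM E rmorphM rmorphXn.
  (* For [i = 0] the elements [a] and [a'] agree modulo the kernel, so that [m a] would give
     [m a']. *)
  case: i E => // E ma; case/negP: ma'.
  have : m (a - a').
    by apply: m_ker; rewrite rmorphB; move: E; rewrite !expr0 !mul1r => ->; rewrite subrr.
  by move=> h; rewrite -[a'](subKr a) mD // mN.
(* After [j.+1] divisions, multiplying by [b] and cancelling [pi ^+ j] puts [e ^+ j.+1 * c] into the
   prime, although [e] and [c] are outside. *)
have [//|[a' E]] := step j.+1; exfalso.
have : ev (e ^+ j.+1 * c - pi * (a' * b)) = 0.
  have -> : e ^+ j.+1 * c - pi * (a' * b) = e ^+ j.+1 * c - a' * (pi * b) by ring.
  apply: (mulfI (expf_neq0 j ev_pi)); rewrite mulr0 -rmorphXn -rmorphM mulrBr rmorphB.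
  have -> : pi ^+ j * (e ^+ j.+1 * c) = e ^+ j.+1 * (pi ^+ j * c) by ring.
  rewrite [X in X - _]rmorphM -abE -[X in X - _]rmorphM [e ^+ _ * _]mulrA.
  rewrite [X in X - _]rmorphM E -[X in X - _]rmorphM exprSr.
  by apply/eqP; rewrite subr_eq0; apply/eqP; congr (ev _); ring.
move=> /m_ker; rewrite mDl ?mN ?mM ?m_pi // (negPf mc) orbF.
by apply/negP; rewrite munitX.
Qed.

Lemma has_val_ex x : x != 0 -> exists k, has_val x k.
Proof.
move=> x0; have [a [b [b0 xE]]] := ev_frac x.
have a0 : ev a != 0 by rewrite -xE mulf_neq0.
have [k ka _] := has_val_ev a0; have [l lb _] := has_val_ev b0.
exists (k%:Z - l%:Z); rewrite -[x](mulfK b0) xE.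
exact: has_valM (has_valV _).
Qed.

Definition prime_val (x : K) : int := if x == 0 then 0 else xget 0 [set k | has_val x k].

Lemma prime_valP x : x != 0 -> has_val x (prime_val x).
Proof.
move=> x0; rewrite /prime_val (negPf x0); have [k xk] := has_val_ex x0.
exact: (xgetPex 0 (ex_intro _ k xk)).
Qed.

Lemma has_val_neq0 x k : has_val x k -> x != 0.
Proof.
move=> [a [s [ma ms xs]]]; apply/eqP => x0; move: xs; rewrite x0 mul0r => /esym/eqP.
by rewrite mulf_eq0 (negPf (piz k)) (negPf (unit_neq0 ma)).
Qed.

Lemma prime_valE x k : has_val x k -> prime_val x = k.
Proof.
by move=> xk; apply: (has_val_inj _ xk); apply: prime_valP; exact: has_val_neq0 xk.
Qed.

(** For the ultrametric inequality, the smaller power of [pi] is factored out of the sum; what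
    remains is a fraction whose denominator lies outside the prime and whose numerator is in the
    image of [A], so has nonnegative valuation by [has_val_ev]. *)
Lemma prime_val_place : finite_place prime_val.
Proof.
split.
- by rewrite /prime_val eqxx.
- by move=> x y x0 y0; apply: prime_valE; apply: has_valM; exact: prime_valP.
- move=> x y; wlog xy : x y / prime_val x <= prime_val y.
    move=> h x0 y0 xy0; have /orP[xy|yx] := le_total (prime_val x) (prime_val y).
      exact: h.
    by rewrite addrC minC; apply: h; rewrite // addrC.
  move=> x0 y0 xy0; rewrite min_l //.
  move: (prime_valP x0) (prime_valP y0) xy.
  move: (prime_val x) (prime_val y) => k l [a [s [ma ms xs]]] [b [r [mb mr yr]]] kl.
  have [n ln] : exists n : nat, l = k + n.
    by exists `|l - k|%N; rewrite gez0_abs ?subr_ge0 // addrCA subrr addr0.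
  pose c := a * r + pi ^+ n * b * s.
  have xyc : (x + y) * ev (s * r) = ev pi ^ k * ev c.
    rewrite /c rmorphD !rmorphM rmorphXn /= mulrDl !mulrA xs [y * _ * _]mulrAC yr ln.
    rewrite expfzDr // -exprnP; ring.
  have sr0 : ~~ m (s * r) by rewrite mM negb_or ms.
  have c0 : ev c != 0.
    apply/eqP => c0; move: xyc; rewrite c0 mulr0 => /eqP.
    by rewrite mulf_eq0 (negPf xy0) (negPf (unit_neq0 sr0)).
  have [j jc _] := has_val_ev c0.
  suff -> : prime_val (x + y) = k + j by rewrite lerDl.
  apply: prime_valE; have -> : x + y = ev pi ^ k * ev c / ev (s * r).
    by rewrite -xyc mulfK // unit_neq0.
  rewrite -[k + j]addr0 -oppr0; apply: has_valM (has_valV (has_val_unit sr0)).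
  apply: has_valM => //; exists 1, 1; rewrite rmorph1 !mulr1; split=> //.
- by exists (ev pi) => //; exact/prime_valE/has_val_pi.
Qed.

Hypothesis m_inv : forall a, ~~ m a -> exists b, m (a * b - 1).
Variables (T : finType) (r : T -> A).
Hypothesis r_surj : forall a, exists t, m (a - r t).
Hypothesis r_inj : forall t u, m (r t - r u) -> t = u.

Let ideal_ev a : m a -> valuation_ideal prime_val (ev a).
Proof.
move=> ma a0; have [k ka k0] := has_val_ev a0.
by rewrite (prime_valE ka); have := k0 ma; lia.
Qed.

Let idealE x : valuation_ideal prime_val x = val_ge prime_val 1 x :> Prop.
Proof. by apply/propext; split=> [/implyP//|/implyP]. Qed.

(** A denominator outside [m] is invertible modulo [m], so each element of the valuation ring is
    congruent to one from [A], hence to some [r t]. Thus [r] represents every residue class exactly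
    once. *)
Lemma prime_val_norm : place_norm prime_val = #|T|.
Proof.
have vP := prime_val_place.
pose coset t := [set b | valuation_ideal prime_val (b - ev (r t))].
have -> : place_norm prime_val = #|` fset_set [set coset t | t in [set: T]]|.
  rewrite /place_norm; congr #|` fset_set _|; apply/seteqP; split=> C /=; last first.
    move=> [t _ <-]; exists (ev (r t)) => // rt0.
    by have [k kt _] := has_val_ev rt0; rewrite (prime_valE kt).
  move=> [x xv <-]; have [t xt] : exists t, valuation_ideal prime_val (x - ev (r t)).
    have [x0|x0] := eqVneq x 0.
      have [t rt] := r_surj 0; exists t; rewrite x0 -(rmorph0 ev) -rmorphB; exact: ideal_ev.
    have := xv x0; have := prime_valP x0; case: (prime_val x) => // k [a [s [ma ms xs]]] _.
    have [b sb] := m_inv ms; have [t abt] := r_surj (pi ^+ k * a * b); exists t.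
    have -> : x - ev (r t) = ev (pi ^+ k * a * b - r t) - ev (pi ^+ k * a * (s * b - 1)) / ev s.
      have s0 := unit_neq0 ms; rewrite !rmorphB !rmorphM rmorphB rmorphM rmorph1.
      have -> : x = ev (pi ^+ k) * ev a / ev s by rewrite rmorphXn exprnP -xs mulfK.
      by field.
    rewrite idealE; apply: val_geD => //; first by rewrite -idealE; exact: ideal_ev.
    rewrite val_geN // -[1]addr0; apply: val_geM => //.
      by rewrite -idealE; apply: ideal_ev; rewrite mM sb orbT.
    by apply/implyP => _; rewrite placeV // (prime_valE (has_val_unit ms)) oppr0.
  rewrite idealE in xt; exists t => //; apply/seteqP; split=> y; rewrite /coset /= !idealE => h.
    have -> : y - x = (y - ev (r t)) - (x - ev (r t)) by ring.
    by apply: val_geD; rewrite ?val_geN.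
  have -> : y - ev (r t) = (y - x) + (x - ev (r t)) by ring.
  exact: val_geD.
rewrite fset_set_image; last exact: finite_finset.
rewrite card_imfset /=; last first.
  move=> t u tu; apply: r_inj; apply: contrapT => /negP h.
  have : coset t (ev (r t)) by rewrite /coset /= subrr => /eqP.
  rewrite tu /coset /= -rmorphB => /(_ (unit_neq0 h)).
  by rewrite (prime_valE (has_val_unit h)).
have -> : fset_set [set: T] = [fset t | t in T]%fset.
  apply/fsetP => t; rewrite in_fset_set; last exact: finite_finset.
  by rewrite in_setT; apply/esym; apply/imfsetP; exists t.
by rewrite card_imfset /= ?cardE.
Qed.

End PlaceOfPrime.

(** * Irreducible factors over fields and over the integers, and reduction modulo a prime *)

Local Notation pZtoQ := (map_poly (intr : int -> rat)).

Lemma reducible_polyP (F : fieldType) (q : {poly F}) :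
  (1 < size q)%N -> ~ irreducible_poly q ->
  exists2 d, d %| q & (1 < size d < size q)%N.
Proof.
move=> q1 qN; apply: contrapT => h; apply: qN; split=> // d d1 dq.
have q0 : q != 0 by rewrite -size_poly_gt0 ltnW.
have dsz : (size d <= size q)%N := dvdp_leq q0 dq.
rewrite -(dvdp_size_eqp dq) eqn_leq dsz leqNgt; apply/negP => dq'.
apply: h; exists d => //; rewrite dq' andbT ltn_neqAle eq_sym d1 size_poly_gt0.
by apply: contraNneq q0 => d0; rewrite d0 dvd0p in dq.
Qed.

Lemma irreducible_factorization (F : fieldType) (q : {poly F}) : q != 0 ->
  exists s : seq {poly F},
    [/\ forall h, h \in s -> irreducible_poly h /\ h \is monic,
        q %= \prod_(h <- s) h & (\sum_(h <- s) (size h).-1 = (size q).-1)%N].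
Proof.
have [n] := ubnP (size q); elim: n q => // n IH q /ltnSE szq q0.
have [sz1|sz1] := leqP (size q) 1.
  exists [::]; rewrite !big_nil; split=> //; last by case: (size q) sz1 => [|[]].
  by rewrite -size_poly_eq1 eqn_leq sz1 size_poly_gt0.
have [q_irr|/(reducible_polyP sz1)[d /dvdpP[r rE] /andP[d1 dq]]] := pselect (irreducible_poly q).
  pose h := (lead_coef q)^-1 *: q.
  have qh : q %= h by rewrite eqp_sym eqp_scale // invr_eq0 lead_coef_eq0.
  exists [:: h]; rewrite !big_seq1; split=> //; last by rewrite (eqp_size qh).
  move=> _ /[!inE]/eqP->; split; last by rewrite monicE lead_coefZ mulVf ?lead_coef_eq0.
  split; first by rewrite -(eqp_size qh).
  move=> d d1 dh; apply: eqp_trans (qh); apply: q_irr.2 => //.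
  by rewrite (eqp_dvdr _ qh).
have /andP[r0 d0] : (r != 0) && (d != 0) by rewrite -negb_or -mulf_eq0 -rE.
have szE : size q = (size r + size d).-1 by rewrite rE size_mul.
have r1 : (0 < size r)%N by rewrite size_poly_gt0.
have [||s [sP ds ss]] := IH d; [exact: leq_trans dq szq|by []|].
have rn : (size r < n)%N.
  move: szE d1 szq; move: (size q) (size r) (size d) => x y z; lia.
have [//|//|t [tP rt ts]] := IH r.
exists (t ++ s); rewrite !big_cat /= ss ts; split.
- by move=> h; rewrite mem_cat => /orP[/tP|/sP].
- by rewrite rE; apply: eqp_trans (eqp_mulr _ rt) (eqp_mull _ ds).
- by rewrite szE; move: d1 r1; move: (size r) (size d) => y z; lia.
Qed.

(** By Gauss's lemma a rational factor can be taken integral. The two leading coefficients have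
    product 1, so they are the same sign, and scaling both factors by it makes them monic. *)
Lemma monic_int_factorP (G : {poly int}) :
  G \is monic -> (1 < size G)%N -> ~ irreducible_poly (pZtoQ G) ->
  exists A B, [/\ G = A * B, A \is monic, B \is monic, (1 < size A < size G)%N
    & (1 < size B < size G)%N].
Proof.
move=> Gm G1; have szQ (a : {poly int}) : size (pZtoQ a) = size a.
  by rewrite size_map_inj_poly //; exact: intr_inj.
move=> /reducible_polyP[|d + /andP[d1 dG]]; first by rewrite szQ.
move=> /dvdpP_rat_int[A [c c0 dE] [B GE]].
move: d1 dG; rewrite dE size_scale // !szQ => A1 AG.
have : lead_coef A * lead_coef B = 1 by rewrite -lead_coefM -GE (monicP Gm).
set a := lead_coef A; set b := lead_coef B => ab1.
have aa : a * a = 1.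
  have : `|a| * `|b| = 1 by rewrite -normrM ab1.
  by move: ab1; clear; case: a => [[|[|a]]|[|a]]; case: b => [[|[|b]]|[|b]]; nia.
have ba : b = a by rewrite -[b]mul1r -aa -mulrA ab1 mulr1.
have a0 : a != 0 by apply: contra_eq_neq aa => ->; rewrite mul0r eq_sym oner_eq0.
have A0 : A != 0 by rewrite -lead_coef_eq0.
have B0 : B != 0 by rewrite -lead_coef_eq0 -/b ba.
have szE : size G = (size A + size B).-1 by rewrite GE size_mul.
exists (a *: A), (a *: B); rewrite !size_scale // A1 AG; split=> //.
- by rewrite -scalerAl -scalerAr scalerA aa scale1r.
- by rewrite monicE lead_coefZ aa.
- by rewrite monicE lead_coefZ -/b ba aa.
- by move: A1 AG; rewrite szE; move: (size A) (size B) => y z; lia.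
Qed.

Section Reduction.
Variable p : nat.
Hypothesis p_pr : prime p.

Definition red (a : {poly int}) : {poly 'F_p} := map_poly intr a.
HB.instance Definition _ := GRing.RMorphism.copy red (map_poly intr).

Definition lift (q : {poly 'F_p}) : {poly int} := map_poly (fun x : 'F_p => (x : nat)%:Z) q.

Lemma liftK : cancel lift red.
Proof.
move=> q; apply/polyP => i; rewrite coef_map coef_map_id0 //=.
by rewrite -pmulrn natr_Zp.
Qed.

Lemma redC (z : int) : (red z%:P == 0) = (p %| z)%Z.
Proof.
rewrite /red map_polyC polyC_eq0 /= {1}[z]intEsign rmorphM rmorph_sign mulf_eq0 signr_eq0 /=.
by rewrite -val_eqE /= val_Fp_nat // dvdzE.
Qed.

Lemma red_eq0 a : red a = 0 -> exists b, a = p%:R * b.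
Proof.
move=> a0; exists (map_poly (fun z => (z %/ p)%Z) a).
rewrite mulr_natl; apply/polyP => i; rewrite coefMn coef_map_id0 ?div0z //.
have : (p %| a`_i)%Z.
  by rewrite -redC /red map_polyC polyC_eq0 -coef_map -/(red a) a0 coef0.
by move=> /divzK {1}<-; rewrite -mulr_natr natz.
Qed.

Lemma red_p : red p%:R = 0.
Proof. by rewrite rmorph_nat -(rmorph_nat polyC) pchar_Fp_0 // polyC0. Qed.

End Reduction.

(** The two gcds on the left are coprime, so their product divides the one on the right. *)
Lemma separable_mul_gcd (F : fieldType) (a b h : {poly F}) :
  coprimep a b -> a != 0 -> b != 0 ->
  ((size (gcdp a h)).-1 + (size (gcdp b h)).-1 <= (size (gcdp (a * b) h)).-1)%N.
Proof.
move=> ab a0 b0.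
have cop : coprimep (gcdp a h) (gcdp b h).
  apply: coprimep_dvdl (dvdp_gcdl b h) _; exact: coprimep_dvdr (dvdp_gcdl a h) ab.
have : gcdp a h * gcdp b h %| gcdp (a * b) h.
  by rewrite dvdp_gcd dvdp_mul ?dvdp_gcdl // Gauss_dvdp // !dvdp_gcdr.
have /andP[ga gb] : (gcdp a h != 0) && (gcdp b h != 0).
  by rewrite !gcdp_eq0 !negb_and a0 b0.
move=> /dvdp_leq; rewrite gcdp_eq0 negb_and mulf_neq0 // => /(_ isT).
rewrite size_mul //; have := ga; have := gb; rewrite -!size_poly_gt0; lia.
Qed.

Lemma size_red p (a : {poly int}) : prime p -> a \is monic -> size (red p a) = size a.
Proof.
by move=> p_pr am; rewrite size_map_poly_id0 // (monicP am) oner_neq0.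
Qed.

(** An averaging argument: when [G = A * B], the degrees add up to that of [G] and the gcd degrees
    to at most that for [G], so [A] or [B] inherits the inequality. Induction on the degree then
    reaches an irreducible factor. *)
Lemma good_irreducible_factor (p c : nat) (G : {poly int}) (H : {poly 'F_p}) :
  prime p -> G \is monic -> (1 < size G)%N -> separable_poly (red p G) ->
  (c * (size (gcdp (red p G) H)).-1 <= (size G).-1)%N ->
  exists g, [/\ g \is monic, irreducible_poly (pZtoQ g), (g %| G)%R,
    separable_poly (red p g) & (c * (size (gcdp (red p g) H)).-1 <= (size g).-1)%N].
Proof.
move=> p_pr; have [n] := ubnP (size G); elim: n G => // n IH G /ltnSE szG Gm G1 sep le.
have [G_irr|/(monic_int_factorP Gm G1)[A [B [GE Am Bm /andP[A1 AG] /andP[B1 BG]]]]] :=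
    pselect (irreducible_poly (pZtoQ G)).
  by exists G.
move: sep; rewrite GE rmorphM separable_mul => /and3P[sA sB AB].
have redN0 a : a \is monic -> red p a != 0.
  by move=> am; rewrite -size_poly_gt0 size_red // size_poly_gt0 monic_neq0.
have szE : size G = (size A + size B).-1 by rewrite GE size_mul ?monic_neq0.
have := separable_mul_gcd H AB (redN0 _ Am) (redN0 _ Bm).
rewrite -rmorphM -GE => sz.
have : (c * (size (gcdp (red p A) H)).-1 <= (size A).-1)%N \/
       (c * (size (gcdp (red p B) H)).-1 <= (size B).-1)%N.
  move: sz le A1 B1; rewrite szE.
  move: (size (gcdp (red p A) H)).-1 (size (gcdp (red p B) H)).-1 (size (gcdp (red p G) H)).-1.
  move: (size A) (size B) => x y u v w; nia.
case=> /IH h.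
  have [|//|//|//|g [gm gi gA gs gl]] := h _; first exact: leq_trans AG szG.
  by exists g; split=> //; rewrite GE dvdp_mulr.
have [|//|//|//|g [gm gi gA gs gl]] := h _; first exact: leq_trans BG szG.
by exists g; split=> //; rewrite GE dvdp_mull.
Qed.

(** * Places above an unramified prime in a field generated by a root of an integer polynomial *)

Section PlacesAbove.
Variables (p : nat) (K : fieldExtType rat) (theta : K) (g : {poly int}).
Hypothesis p_pr : prime p.
Hypothesis theta_gen : <<1; theta>>%VS = fullv.
Hypothesis g_monic : g \is monic.
Hypothesis g_irr : irreducible_poly (pZtoQ g).
Hypothesis g_sep : separable_poly (red p g).

(** The image is the order Z[theta]. Working with polynomials instead of this subring lets ideals be
    described by reduction modulo [p]. *)
Definition int_eval (a : {poly int}) : K := horner_eval theta (map_poly intr a).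
HB.instance Definition _ := GRing.RMorphism.copy int_eval (horner_eval theta \o map_poly intr).

Hypothesis g_root : int_eval g = 0.

Lemma int_eval_rat a : int_eval a = (map_poly (in_alg K) (pZtoQ a)).[theta].
Proof.
rewrite /int_eval /horner_eval -map_poly_comp; congr _.[_].
by apply: eq_map_poly => z /=; rewrite scaler_int.
Qed.

Lemma int_evalC z : int_eval z%:P = z%:~R.
Proof. by rewrite /int_eval map_polyC /horner_eval hornerC. Qed.

Lemma int_eval_nat n : int_eval n%:R = n%:R.
Proof. exact: rmorph_nat. Qed.

(** Since [g] is irreducible over Q and shares the root [theta] with [a], it divides [a] over Q;
    being monic it does so over the integers. *)
Lemma int_eval_eq0 a : int_eval a = 0 -> exists r, a = g * r.
Proof.
move=> a0; suff /dvdpP_int[r ar] : g %| a by exists r; rewrite {1}ar zprimitive_monic.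
rewrite -dvdp_rat_int -(eqp_dvdl _ (_ : gcdp (pZtoQ g) (pZtoQ a) %= _)) ?dvdp_gcdr //.
apply: g_irr.2; last exact: dvdp_gcdl.
apply/negP => cop; have : coprimep (map_poly (in_alg K) (pZtoQ g)) (map_poly (in_alg K) (pZtoQ a)).
  by rewrite coprimep_map.
move=> /(@coprimep_root _ _ _ theta); rewrite /root -int_eval_rat g_root eqxx => /(_ isT).
by rewrite -int_eval_rat a0 eqxx.
Qed.

Lemma int_eval_frac x : exists (c : {poly int}) (N : int), N != 0 /\ x * N%:~R = int_eval c.
Proof.
have /Fadjoin1_polyP[q ->] : x \in <<1; theta>>%VS by rewrite theta_gen memvf.
have [c [N N0 ->]] := rat_poly_scale q; exists c, N; split=> //.
rewrite int_eval_rat map_polyZ hornerZ fmorphV rmorph_int mulrAC mulVf ?mul1r //.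
by rewrite -(rmorph_int (in_alg K)) fmorph_eq0 intr_eq0.
Qed.

Lemma dim_le_size : (\dim {:K} <= (size g).-1)%N.
Proof.
rewrite -theta_gen dim_Fadjoin dimv1 muln1.
have : minPoly 1 theta %| map_poly (in_alg K) (pZtoQ g).
  apply: minPoly_dvdp; last by rewrite /root -int_eval_rat g_root.
  exact: alg_polyOver.
move=> /dvdp_leq; rewrite map_poly_eq0 map_poly_eq0_id0 ?(monicP g_monic) ?intr_eq0 // monic_neq0 //.
move=> /(_ isT); rewrite size_minPoly size_map_poly size_map_inj_poly //; last exact: intr_inj.
by case: (size g).
Qed.

(** The Kummer-Dedekind correspondence: the place belongs to the prime (p, h(theta)) of Z[theta],
    with residue field F_p[X]/(h). Separability of [g] modulo [p] makes [p] a uniformiser. *)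
Lemma place_of_factor h : irreducible_poly h -> h %| red p g ->
  exists v : K -> int, [/\ finite_place v, place_norm v = (p ^ (size h).-1)%N, v p%:R = 1,
    forall a, ~~ (h %| red p a) -> int_eval a != 0 /\ v (int_eval a) = 0
  & forall a, int_eval a != 0 -> h %| red p a -> 0 < v (int_eval a)].
Proof.
move=> h_irr hg.
pose m : pred {poly int} := fun a => h %| red p a.
(* By separability [h] does not divide [red p g %/ h], so [e] is a unit at [h], while [e]
   times an element divisible by [h] vanishes modulo [p] and [g]. *)
pose e := lift (red p g %/ h).
have gE : red p g %/ h * h = red p g by rewrite divpK.
have redN0 : red p g != 0 by rewrite -size_poly_gt0 size_red // size_poly_gt0 monic_neq0.
have h0 : h != 0 by apply: contraNneq redN0 => h0; rewrite -gE h0 mulr0.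
have h_prime a : ~~ (h %| a) -> coprimep h a.
  apply: contraNT => hN; have /h_irr.2 : size (gcdp h a) != 1 by [].
  by move=> /(_ (dvdp_gcdl _ _)) /eqp_dvdl <-; exact: dvdp_gcdr.
have mD a b : m a -> m b -> m (a + b) by rewrite /m rmorphD; exact: dvdp_add.
have mM a b : m (a * b) = m a || m b.
  rewrite /m rmorphM; have [ha|ha] := boolP (h %| red p a); first by rewrite dvdp_mulr.
  by rewrite Gauss_dvdpr // h_prime.
have m1 : ~~ m 1.
  by rewrite /m rmorph1 dvdp1; have := h_irr.1; case: (size h) => [|[]].
have m_ker a : int_eval a = 0 -> m a.
  by move=> /int_eval_eq0[r ->]; rewrite /m rmorphM dvdp_mulr.
have m_pi : m p%:R by rewrite /m red_p // dvdp0.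
have K0 (z : int) : z != 0 -> z%:~R != 0 :> K.
  by move=> z0; rewrite -(rmorph_int (in_alg K)) fmorph_eq0 intr_eq0.
have ev_pi : int_eval p%:R != 0.
  by rewrite int_eval_nat (K0 p%:Z) //; have := prime_gt0 p_pr; lia.
have e_unit : ~~ m e.
  rewrite /m liftK //; apply/negP => hd.
  move: g_sep; rewrite -gE separable_mul => /and3P[_ _].
  move=> /coprimepP/(_ h hd (dvdpp h)); rewrite -size_poly_eq1.
  by have := h_irr.1; case: (size h) => [|[]].
have e_absorb a : m a -> exists b, int_eval (e * a) = int_eval (p%:R * b).
  move=> /dvdpP[c ac].
  have [b E] : exists b, e * a - g * lift c = p%:R * b.
    apply: red_eq0 => //; rewrite rmorphB !rmorphM /= /e !liftK // ac -{2}gE; ring.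
  exists b; rewrite -E rmorphB (rmorphM _ g) /= g_root mul0r subr0 //.
have ev_frac x : exists a b, int_eval b != 0 /\ x * int_eval b = int_eval a.
  have [c [N [N0 E]]] := int_eval_frac x.
  by exists c, N%:P; rewrite int_evalC K0.
have ev_norm a : int_eval a != 0 ->
    exists b j c, ~~ m c /\ int_eval (a * b) = int_eval (p%:R ^+ j * c).
  (* An integer [N] clears the denominator of the inverse of [int_eval a]; its part prime to [p] is
     a unit at the place. *)
  move=> a0; have [b [N [N0 E]]] := int_eval_frac (int_eval a)^-1.
  have [j [N' [pN' NE]]] : exists j (N' : int), ~~ (p %| N')%Z /\ N = p%:R ^+ j * N'.
    have Nn : (0 < `|N|)%N by rewrite absz_gt0.
    have [k pk NE] := pfactor_coprime p_pr Nn.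
    exists (logn p `|N|), (Num.sg N * k); split.
      by rewrite dvdzE abszM absz_sg N0 mul1n /= -prime_coprime.
    have -> : p%:R ^+ logn p `|N| * (Num.sg N * k) = Num.sg N * (k * p ^ logn p `|N|)%N.
      by rewrite PoszM -natrX natz; ring.
    by rewrite -NE abszE -numEsg.
  exists b, j, N'%:P; split.
    rewrite /m; apply/negP => hN; move: pN'; rewrite -redC //.
    move: hN; rewrite /red map_polyC => hN; apply/negP; rewrite negbK.
    apply: contraLR h_irr.1 => c0; rewrite -leqNgt.
    by apply: leq_trans (dvdp_leq c0 hN) _; exact: size_polyC_leq1.
  rewrite !rmorphM /= -E mulrA mulfV // mul1r int_evalC NE intrM.
  by congr (_ * _); rewrite !rmorphXn /= int_eval_nat rmorph_nat.
have vP := prime_val_place mD mM m1 m_ker m_pi ev_pi e_unit e_absorb ev_frac ev_norm.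
have vE := prime_valE mD mM m1 m_ker m_pi ev_pi e_unit e_absorb ev_frac ev_norm.
set v := prime_val _ _ _ in vP vE.
exists v; split=> //.
(* Residue classes are represented by lifts of the polynomials of degree less than that of [h]. *)
- pose r (t : 'rV['F_p]_(size h).-1) := lift (rVpoly t).
  rewrite (@prime_val_norm _ _ _ m p%:R e mD mM m1 m_ker m_pi ev_pi e_unit e_absorb
    ev_frac ev_norm _ _ r).
  + by rewrite card_mx mul1n card_Fp.
  + move=> a ha; have /Bezout_eq1_coprimepP[[u w] /= uw] := h_prime _ ha.
    exists (lift w); rewrite /m rmorphB rmorphM rmorph1 /= liftK // -uw.
    by rewrite mulrC opprD addrCA subrr addr0 dvdpNr dvdp_mull.
  + move=> a; exists (poly_rV (red p a %% h)); rewrite /m /r rmorphB /= liftK //.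
    rewrite poly_rV_K; last by have := ltn_modpN0 (red p a) h0; case: (size h).
    by rewrite {1}(divp_eq (red p a) h) addrK dvdp_mull.
  + move=> t u; rewrite /m /r rmorphB /= !liftK // -linearB /= => htu.
    apply/eqP; rewrite -subr_eq0; apply/eqP; apply: (can_inj rVpolyK); rewrite linear0.
    apply: contraTeq htu => tu0; rewrite gtNdvdp //.
    by apply: leq_ltn_trans (size_poly _ _) _; have := h_irr.1; case: (size h).
- rewrite -int_eval_nat; apply: vE; exact: has_val_pi m1.
- move=> a ma; split; first by apply: contraNneq ma => /m_ker.
  by apply: vE; exact: has_val_unit.
- move=> a a0 ma; have [k ka k0] := has_val_ev mD mM m1 m_ker m_pi ev_pi e_unit e_absorb ev_norm a0.
  by rewrite (vE _ _ ka) ltz_nat k0.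
Qed.

End PlacesAbove.

(** * Lower bounds for the height *)

Section HeightBound.
Variable R : realType.

Lemma finite_absv_le1 (K : fieldType) (v : K -> int) x :
  val_ge v 0 x -> finite_absv R v x <= 1.
Proof.
rewrite /val_ge /finite_absv; have [//|x0] := eqVneq x 0.
move=> /=; case: (v x) => // k _; rewrite -exprnN -natrX.
(* [place_norm v] is [0] when the residue field is infinite. *)
case: (_ ^ _)%N => [|M]; first by rewrite invr0.
by rewrite invf_le1 ?ltr0Sn // ler1n.
Qed.

Lemma finite_absv1 (K : fieldType) (v : K -> int) : finite_place v -> finite_absv R v 1 = 1.
Proof. by move=> vP; rewrite /finite_absv oner_eq0 place1 // oppr0 expr0z. Qed.

Lemma number_field_height_ge (K : fieldExtType rat) (n N : nat) (u : 'rV[K]_n.+1)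
    (s : seq (K -> int)) (b : (K -> int) -> R) :
  (0 < N)%N -> u 0 0 = 1 ->
  (forall v, finite_place v -> v N%:R = 0 -> forall i, val_ge v 0 (u 0 i)) ->
  uniq s -> (forall v, v \in s -> finite_place v /\ 0 < v N%:R) ->
  (forall v, v \in s -> exists i, finite_absv R v (u 0 i) >= expR (b v)) ->
  \sum_(v <- s) b v <= (\dim {:K})%:R * number_field_height R u.
Proof.
move=> N0 u0 uN s_uniq sP sb.
have d0 : (\dim {:K})%:R != 0 :> R by rewrite pnatr_eq0 -lt0n adim_gt0.
rewrite /number_field_height mulrA divff // mul1r.
set F := fun v : K -> int => ln (\big[Num.max/0]_(i < n.+1) finite_absv R v (u 0 i)).
have max_ge1 (G : 'I_n.+1 -> R) : G 0 = 1 -> 1 <= \big[Num.max/0]_i G i.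
  by move=> <-; exact: le_bigmax.
have F0 v : finite_place v -> 0 <= F v.
  by move=> vP; apply: ln_ge0; apply: max_ge1; rewrite u0 finite_absv1.
pose D := [set v : K -> int | finite_place v /\ 0 < v N%:R].
have D_fin : finite_set D by exact: finite_places_over.
have -> : \sum_(v \in finite_place (K := K)) F v = \sum_(v <- fset_set D) F v.
  rewrite -fsbig_finite //; apply/esym/fsbig_widen => [v []//|v [vP vD] /=].
  have vN : v N%:R = 0.
    apply/eqP; have := val_ge_nat vP N; rewrite /val_ge; case: eqVneq => [->|_ /=].
      by rewrite place0.
    by rewrite le_eqVlt => /orP[/eqP->//|vN]; case: vD.
  apply/eqP; rewrite eq_le F0 // andbT; apply: ln_le0.
  apply: bigmax_le => // i _; apply: finite_absv_le1; exact: uN.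
apply: (@le_trans _ _ (\sum_(v <- fset_set D) F v)); last first.
  rewrite lerDr; apply: fsumr_ge0 => sg [g ->]; apply: ln_ge0; apply: max_ge1.
  by rewrite u0 rmorph1 ComplexField.Normc.normc1.
rewrite [leRHS](bigID (mem s)) /= -[leLHS]addr0; apply: lerD; last first.
  rewrite big_seq_cond; apply: sumr_ge0 => v /andP[]; rewrite in_fset_set // inE => -[vP _] _.
  exact: F0.
have -> : \sum_(v <- fset_set D | v \in s) F v = \sum_(v <- s) F v.
  rewrite -big_filter; apply: perm_big; apply: uniq_perm => //.
    by rewrite filter_uniq // fset_uniq.
  move=> v; rewrite mem_filter; apply: andb_idr => vs.
  by rewrite in_fset_set // inE; exact: sP.
rewrite big_seq [leRHS]big_seq; apply: ler_sum => v vs.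
have [i bi] := sb v vs; rewrite -[leLHS]expRK /F ler_ln ?posrE ?expR_gt0 //.
  by apply: le_trans bi _; exact: le_bigmax.
by apply: lt_le_trans (expR_gt0 _) (le_trans bi _); exact: le_bigmax.
Qed.

End HeightBound.

Lemma int_eval_sum (K : fieldExtType rat) (theta : K) (a : {poly int}) :
  int_eval theta a = \sum_(i < size a) (a`_i)%:~R * theta ^+ i.
Proof.
rewrite /int_eval /horner_eval (@horner_coef_wide _ (size a)) ?size_poly //.
by apply: eq_bigr => i _; rewrite coef_map.
Qed.

(** At a pole of [theta] the leading term of [g] would strictly dominate all the others, and the sum
    could not vanish. *)
Lemma val_ge_monic_root (K : fieldExtType rat) (theta : K) (g : {poly int}) (v : K -> int) :
  finite_place v -> g \is monic -> int_eval theta g = 0 -> val_ge v 0 theta.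
Proof.
move=> vP gm g0; apply/implyP => th0; rewrite leNgt; apply/negP => vth.
have [d szg] : exists d, size g = d.+1.
  by exists (size g).-1; rewrite prednK // size_poly_gt0 monic_neq0.
have gd : g`_d = 1 by have := monicP gm; rewrite lead_coefE szg.
move: g0; rewrite int_eval_sum szg big_ord_recr /= gd mul1r addrC.
have td0 : theta ^+ d != 0 by rewrite expf_neq0.
have [|/eqP ne0 _] := @placeD_lt _ v vP _ (\sum_(i < d) (g`_i)%:~R * theta ^+ i) td0; last by [].
apply: val_ge_sum => // i _.
rewrite -(add0r (v (theta ^+ d) + 1)); apply: val_geM => //; first exact: val_ge_int.
apply/implyP => _; rewrite (placeX vP d th0) (placeX vP i th0).
have : (i < d)%N := ltn_ord i.
move: (v theta) vth (nat_of_ord i) => x x0 j.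
rewrite -[x *+ d]mulr_natl -[x *+ j]mulr_natl; nia.
Qed.

Lemma val_ge_int_eval (K : fieldExtType rat) (theta : K) (g a : {poly int}) (v : K -> int) :
  finite_place v -> g \is monic -> int_eval theta g = 0 -> val_ge v 0 (int_eval theta a).
Proof.
move=> vP gm g0; have th := val_ge_monic_root vP gm g0.
have thX i : val_ge v 0 (theta ^+ i).
  elim: i => [|i IH]; first by rewrite expr0 /val_ge place1 ?lexx ?implybT.
  by rewrite exprS -[0 : int]addr0; apply: val_geM.
rewrite int_eval_sum; apply: val_ge_sum => // i _.
by have := val_geM vP (val_ge_int vP a`_i) (thX i); rewrite addr0.
Qed.

Lemma separable_prod_uniq (F : fieldType) (s : seq {poly F}) :
  (forall h, h \in s -> size h != 1%N) -> separable_poly (\prod_(h <- s) h) -> uniq s.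
Proof.
elim: s => //= h s IH sz; rewrite big_cons separable_mul => /and3P[_ seps cop].
rewrite IH ?andbT => [| k ks | //]; last by rewrite sz // inE ks orbT.
apply/negP => hs; move: cop => /coprimepP/(_ h (dvdpp h)).
rewrite (big_rem h hs) dvdp_mulr //= => /(_ isT).
by rewrite -size_poly_eq1 (negPf (sz h _)) // mem_head.
Qed.

Section HeightOfFactor.
Variables (R : realType) (p : nat) (K : fieldExtType rat) (theta : K) (g : {poly int}).
Hypothesis p_pr : prime p.
Hypothesis theta_gen : <<1; theta>>%VS = fullv.
Hypothesis g_monic : g \is monic.
Hypothesis g_irr : irreducible_poly (pZtoQ g).
Hypothesis g_sep : separable_poly (red p g).
Hypothesis g_root : int_eval theta g = 0.

(** Let [d] be the gcd and [q] the cofactor of [d] in [red p g]. Each irreducible factor [h] of [q]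
    gives a place where [a i0] is a unit and [N] has valuation at least [e], so it contributes at
    least e deg(h) log p. The total is e deg(q) log p, where c deg(q) is at least (c - 1) deg(g),
    and the degree of [K] is at most deg(g). *)
Lemma number_field_height_factor (n N e c : nat) (u : 'rV[K]_n.+1)
    (a : 'I_n.+1 -> {poly int}) (i0 : 'I_n.+1) :
  (0 < N)%N -> (0 < e)%N -> (p ^ e %| N)%N -> u 0 0 = 1 ->
  (forall i, u 0 i * N%:R = int_eval theta (a i)) ->
  (0 < c)%N -> (c * (size (gcdp (red p g) (red p (a i0)))).-1 <= (size g).-1)%N ->
  (c.-1 * e)%:R * ln p%:R <= c%:R * number_field_height R u.
Proof.
move=> N0 e0 peN u0 uN c0 gcd_le.
have rg0 : red p g != 0 by rewrite -size_poly_gt0 size_red // size_poly_gt0 monic_neq0.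
set d := gcdp _ _ in gcd_le.
have d0 : d != 0 by rewrite gcdp_eq0 negb_and rg0.
have qE : red p g %/ d * d = red p g by rewrite divpK // dvdp_gcdl.
set q := red p g %/ d in qE.
have q0 : q != 0 by apply: contraNneq rg0 => q0; rewrite -qE q0 mul0r.
have [s [sP qs sz_s]] := irreducible_factorization q0.
have h_dvd h : h \in s -> h %| q.
  by move=> hs; rewrite (eqp_dvdr _ qs) (big_rem h) //= dvdp_mulr.
have size_irr h : h \in s -> size h != 1%N.
  by move=> /sP[[h1 _] _]; case: (size h) h1 => [|[]].
have [q_sep qd_cop] : separable_poly q /\ coprimep q d.
  by move: g_sep; rewrite -qE separable_mul; case/and3P.
have s_uniq : uniq s.
  apply: (separable_prod_uniq size_irr); by rewrite -(eqp_separable qs).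
have h_ndvd h : h \in s -> ~~ (h %| red p (a i0)).
  move=> hs; apply/negP => ha.
  have hd : h %| d by rewrite dvdp_gcd ha andbT -qE dvdp_mulr // h_dvd.
  move: qd_cop => /coprimepP/(_ h (h_dvd h hs) hd).
  by rewrite -size_poly_eq1 (negPf (size_irr h hs)).
have /choice[V VP] : forall h, exists v : K -> int, h \in s ->
    [/\ finite_place v, place_norm v = (p ^ (size h).-1)%N, v p%:R = 1,
    forall a, ~~ (h %| red p a) -> int_eval theta a != 0 /\ v (int_eval theta a) = 0
  & forall a, int_eval theta a != 0 -> h %| red p a -> 0 < v (int_eval theta a)].
  move=> h; have [hs|] := boolP (h \in s); last by exists (fun _ => 0).
  have [|v vP] := @place_of_factor p K theta g p_pr theta_gen g_monic g_irr g_sep g_root h (sP h hs).1.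
    by rewrite -qE dvdp_mulr // h_dvd.
  by exists v.
(* For distinct factors [h] and [k], the value of [lift h] is a unit at the place of [k] but has
   positive valuation at that of [h]. *)
have V_inj : {in s &, injective V}.
  move=> h k hs ks hk; apply/eqP/negPn/negP => hk_ne.
  have hk_dvd : ~~ (k %| h).
    apply/negP => kh; have [_ /(_ _ (size_irr _ ks) kh)] := (sP h hs).1.
    by rewrite eqp_monic ?(sP _ _).2 // ?(sP h hs).2 ?(sP k ks).2 // eq_sym (negPf hk_ne).
  have [_ _ _ _ hpos] := VP h hs; have [_ _ _ kz _] := VP k ks.
  have [|ne0 kz0] := kz (lift h); first by rewrite liftK.
  by have := hpos (lift h) ne0; rewrite liftK // dvdpp hk kz0 => /(_ isT).
have p_gt0 := prime_gt0 p_pr.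
have natK m : (0 < m)%N -> m%:R != 0 :> K.
  by move=> m0; rewrite -(rmorph_nat (in_alg K)) fmorph_eq0 pnatr_eq0 -lt0n.
have vN_ge h : h \in s -> e%:Z <= V h N%:R.
  move=> hs; have [vP _ vp _ _] := VP h hs.
  have /dvdnP[M NE] := peN; have M0 : (0 < M)%N by move: N0; rewrite NE muln_gt0 => /andP[].
  rewrite NE natrM natrX placeM ?expf_neq0 ?natK // placeX ?natK // vp.
  by have := val_ge_nat vP M; rewrite /val_ge natK //= natz lerDr.
(* The bounds come indexed by factors but are required as a function of the place; by injectivity of
   [V] the sum has one term for each place of [map V s]. *)
pose b v : R := \sum_(h <- s | V h == v) (e * (size h).-1)%:R * ln p%:R.
have bV h : h \in s -> b (V h) = (e * (size h).-1)%:R * ln p%:R.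
  move=> hs.
  rewrite /b big_seq_cond (big_rem h) //= hs eqxx /= big1_seq ?addr0 //.
  move=> k /andP[/andP[ks /eqP hk]]; rewrite (mem_rem_uniq _ s_uniq) inE => /andP[/eqP kh _].
  by case: kh; apply: V_inj.
have H : \sum_(v <- map V s) b v <= (\dim {:K})%:R * number_field_height R u.
  apply: (@number_field_height_ge R K n N u) => //.
  - move=> v vP vN i; have := val_ge_int_eval (a i) vP g_monic g_root.
    rewrite -uN /val_ge mulf_eq0 negb_or natK // andbT.
    by case: (u 0 i =P 0) => // /eqP ui; rewrite placeM ?natK // vN addr0.
  - by rewrite map_inj_in_uniq.
  - move=> v /mapP[h hs ->]; have [vP _ _ _ _] := VP h hs; split=> //.
    by apply: lt_le_trans (vN_ge h hs).
  move=> v /mapP[h hs ->]; exists i0.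
  have [vP v_norm _ vz _] := VP h hs.
  have [a0 va] := vz (a i0) (h_ndvd h hs).
  have ui : u 0 i0 != 0 by apply: contraNneq a0 => ui; rewrite -uN ui mul0r.
  have vu : V h (u 0 i0) = - V h N%:R.
    by apply/eqP; rewrite -addr_eq0 -placeM ?natK // uN va.
  rewrite bV //.
  rewrite /finite_absv (negPf ui) vu opprK v_norm.
  case: (V h N%:R) (vN_ge h hs) => // k; rewrite lez_nat => ek.
  rewrite mulr_natl -lnXn ?ltr0n // lnK ?posrE ?exprn_gt0 ?ltr0n //.
  rewrite -exprnP natrX -exprM mulnC.
  by apply: ler_weXn2l; rewrite ?ler1n // leq_mul2l ek orbT.
have Hs : \sum_(v <- map V s) b v = (e * (size q).-1)%:R * ln p%:R.
  rewrite big_map -sz_s big_distrr /= natr_sum mulr_suml big_seq [RHS]big_seq.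
  by apply: eq_bigr => h hs; exact: bV.
rewrite Hs in H.
have dimg : (\dim {:K} <= (size g).-1)%N by exact: (@dim_le_size K theta g).
have szq : ((size q).-1 + (size d).-1)%N = (size g).-1.
  rewrite -(size_red p_pr g_monic) -qE size_mul //.
  have := q0; have := d0; rewrite -!size_poly_gt0.
  by case: (size q) => // x; case: (size d) => // y; rewrite addnS addSn.
(* Nonnegativity allows [\dim {:K}] to be replaced by the upper bound [(size g).-1]. *)
have h_ge0 : 0 <= number_field_height R u.
  have D0 : 0 < (\dim {:K})%:R :> R by rewrite ltr0n adim_gt0.
  rewrite -(pmulr_rge0 _ D0); apply: le_trans H.
  by rewrite mulr_ge0 // ln_ge0 // ler1n.
have lnp : 0 <= ln p%:R :> R by rewrite ln_ge0 // ler1n.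
have G0 : 0 < (size g).-1%:R :> R.
  by rewrite ltr0n; exact: leq_trans (adim_gt0 {:K}%AS) dimg.
rewrite -(ler_pM2l G0).
have : (e * (size q).-1)%:R * ln p%:R <= (size g).-1%:R * number_field_height R u.
  by apply: le_trans H _; rewrite ler_wpM2r // ler_nat.
move=> {}H.
apply: (@le_trans _ _ (c%:R * ((e * (size q).-1)%:R * ln p%:R))); last first.
  by rewrite [leRHS]mulrCA ler_wpM2l.
rewrite !mulrA ler_wpM2r // -!natrM ler_nat.
have {}gcd_le : (c.-1 * (size g).-1 <= c * (size q).-1)%N.
  move: gcd_le; rewrite -szq; case: (c) c0 => // c' _ /=.
  by rewrite !mulSn addnC leq_add2r mulnDr addnC leq_add2r.
by rewrite [leqLHS]mulnA [leqLHS]mulnC [leqRHS]mulnCA leq_mul2l (mulnC _ c.-1) gcd_le orbT.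
Qed.

End HeightOfFactor.

(** * Reflection-symmetric orbits *)

Section Orbit.
Variable A : comNzRingType.

(** First coordinates along the orbit of (0, t, z) under [f], over any ring so that [t] can also be
    an indeterminate. *)
Fixpoint orb (t : A) n : A :=
  if n is n1.+1 then
    if n1 is n2.+1 then orb t n2 + orb t n1 - orb t n1 ^+ 3 else t
  else 0.

Lemma orbSS t n : orb t n.+2 = orb t n + orb t n.+1 - orb t n.+1 ^+ 3.
Proof. by []. Qed.

(** Run backwards, the recursion becomes the forward one after alternating signs, because the cubic
    is odd. Around a zero at index [m] both sequences therefore have the same two starting
    values. *)
Lemma orb_reflect t m j : orb t m = 0 -> (j <= m)%N ->
  orb t (m + j) = (-1) ^+ j.+1 * orb t (m - j).
Proof.
move=> ym; suff : (j <= m)%N -> orb t (m + j) = (-1) ^+ j.+1 * orb t (m - j) /\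
    ((j < m)%N -> orb t (m + j.+1) = (-1) ^+ j.+2 * orb t (m - j.+1)).
  by move=> h /h[].
elim: j => [_|j IH jm]; last have [yj yj1] := IH (ltnW jm).
  rewrite addn0 subn0 ym mulr0; split=> // m0.
  by rewrite addn1 -(prednK m0) orbSS prednK // ym subn1 expr2 !(addr0, expr0n, subr0, mulNr, mul1r, opprK).
split=> [|jm2]; first exact: yj1.
rewrite !addnS orbSS -addnS yj1 // yj.
have -> : (m - j = (m - j.+2).+2)%N by lia.
have -> : (m - j.+1 = (m - j.+2).+1)%N by lia.
rewrite orbSS !(exprS (-1)).
have : ((-1) ^+ j) ^+ 3 = (-1) ^+ j :> A.
  by rewrite -exprM mulnC exprM; congr (_ ^+ _); ring.
move: ((-1) ^+ j) (orb t (m - j.+2)) (orb t (m - j.+2).+1) => s a b s3.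
have -> : (-1 * (-1 * s) * b) ^+ 3 = s ^+ 3 * b ^+ 3 by ring.
by rewrite s3; ring.
Qed.

(** Reflection gives y_{2m-1} = (-1)^m y_1, which is t for even m, and y_{2m} = 0 turns the
    recursion into y_{2m+1} = y_{2m-1}. *)
Lemma orb_period t m : orb t m = 0 -> ~~ odd m -> (0 < m)%N ->
  orb t m.*2 = 0 /\ orb t m.*2.+1 = t.
Proof.
move=> ym m_even m0; have E j := @orb_reflect t m j ym.
have y2m : orb t m.*2 = 0 by rewrite -addnn E // subnn mulr0.
split=> //; have -> : (m.*2.+1 = (m + m.-1).+2)%N by lia.
have -> : orb t (m + m.-1).+2 = orb t (m + m.-1).
  by rewrite orbSS (_ : (m + m.-1).+1 = m.*2)%N ?y2m; [rewrite expr0n addr0 subr0|lia].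
rewrite E ?leq_pred // prednK // -signr_odd (negPf m_even) mul1r.
by have -> : (m - m.-1 = 1)%N by lia.
Qed.

(** The terms beyond index [m] are folded back by reflection. Only indices below [m] remain, which
    keeps the degree in t below that of y_m. *)
Lemma orb_weighted_sum t m : orb t m = 0 -> ~~ odd m ->
  \sum_(i < m.*2.+1) 2 ^+ (m.*2 - i) * orb t i =
  \sum_(i < m) (2 ^+ (m.*2 - i) - (-1) ^+ i * 2 ^+ i) * orb t i.
Proof.
move=> ym m_even.
have -> : m.*2.+1 = (m + m.+1)%N by rewrite addnS addnn.
rewrite big_split_ord /=; under [RHS]eq_bigr do rewrite mulrBl.
rewrite sumrB; congr (_ + _).
rewrite (reindex_inj rev_ord_inj) /= big_ord_recr /= subSS subnn addn0 ym mulr0 addr0 -sumrN.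
apply: eq_bigr => i _; have im := ltn_ord i.
rewrite subSS -addnn.
have -> : (m + m - (m + (m - i)) = i)%N by lia.
rewrite orb_reflect ?leq_subr //; have -> : (m - (m - i) = i)%N by lia.
rewrite exprS -signr_odd oddB 1?ltnW // (negPf m_even) signr_odd; ring.
Qed.

End Orbit.

Lemma rmorph_orb (A B : comNzRingType) (F : {rmorphism A -> B}) t n :
  F (orb t n) = orb (F t) n.
Proof.
suff : F (orb t n) = orb (F t) n /\ F (orb t n.+1) = orb (F t) n.+1 by case.
elim: n => [|n [IH1 IH2]]; first by rewrite rmorph0.
by split=> //; rewrite !orbSS rmorphB rmorphD rmorphXn /= IH1 IH2.
Qed.

Lemma orb_polyX_size (A : idomainType) n :
  size (orb ('X : {poly A}) n.+1) = (3 ^ n).+1 /\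
  lead_coef (orb ('X : {poly A}) n.+1) = (-1) ^+ n.
Proof.
suff : (size (orb ('X : {poly A}) n) <= 3 ^ n)%N /\
    (size (orb ('X : {poly A}) n.+1) = (3 ^ n).+1 /\
    lead_coef (orb ('X : {poly A}) n.+1) = (-1) ^+ n) by case.
elim: n => [|n [s1 [s2 l2]]]; first by rewrite size_poly0 size_polyX lead_coefX.
have y0 : orb ('X : {poly A}) n.+1 != 0 by rewrite -size_poly_gt0 s2.
rewrite orbSS; move: (orb 'X n) (orb 'X n.+1) s1 s2 l2 y0 => x y s1 s2 l2 y0.
have sc : size (- y ^+ 3) = (3 ^ n.+1).+1.
  have y30 : y ^+ 3 != 0 by rewrite expf_neq0.
  rewrite size_polyN -(prednK (_ : 0 < size (y ^+ 3))%N) ?size_poly_gt0 //.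
  by rewrite size_exp s2 expnSr.
have lt : (size (x + y)%R < size (- y ^+ 3)%R)%N.
  rewrite sc; apply: leq_ltn_trans (size_polyD _ _) _.
  rewrite s2 gtn_max ltnS ltnS expnS; have := expn_gt0 3 n; lia.
split; first by rewrite s2 ltn_exp2l.
rewrite addrC size_polyDl // lead_coefDl // sc lead_coefN lead_coef_exp l2; split=> //.
rewrite [RHS]exprS mulN1r -exprM mulnC exprM; congr (- _ ^+ _); ring.
Qed.

Lemma orb_polyX_size_le (A : idomainType) n : (size (orb ('X : {poly A}) n) <= 3 ^ n)%N.
Proof.
case: n => [|n]; first by rewrite size_poly0.
by rewrite (orb_polyX_size A n).1 ltn_exp2l.
Qed.

(* In characteristic 3 the cubes have zero derivative, so the derivatives follow
   the Fibonacci recursion; mod 3 it changes sign after 4 steps. *)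
Lemma deriv_orb_polyX3 q : (orb ('X : {poly 'F_3}) (4 * q).+2)^`() = (-1) ^+ q.
Proof.
have c3 : (3%:R : {poly 'F_3}) = 0.
  by rewrite -(rmorph_nat polyC) pchar_Fp_0 // polyC0.
have D n : (orb ('X : {poly 'F_3}) n.+2)^`() = (orb 'X n)^`() + (orb 'X n.+1)^`().
  by rewrite orbSS derivB derivD deriv_exp -mulr_natr c3 mulr0 subr0.
elim: q => [|q IH]; first by rewrite D deriv0 derivX add0r.
have -> : (4 * q.+1).+2 = (4 * q).+2.+4 by lia.
rewrite !D exprS mulN1r -IH !D.
move: ((orb _ _)^`()) ((orb _ _)^`()) => a b.
apply/eqP; rewrite -subr_eq0.
rewrite [X in X == 0](_ : _ = 3%:R * (3%:R * a + 2%:R * b)); first by rewrite c3 mul0r.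
ring.
Qed.

Lemma red_orb p n : red p (orb 'X n) = orb 'X n.
Proof. by rewrite rmorph_orb /= /red map_polyX. Qed.

(** For x = 1 mod 3, the second factor of x^3 - 1 = (x - 1)(x^2 + x + 1) is divisible by 3, so each
    cubing gains a factor 3. *)
Lemma dvdn_pow4 k : (3 ^ k.+1 %| 4 ^ 3 ^ k - 1)%N.
Proof.
elim: k => // k IH; have x1 : (0 < 4 ^ 3 ^ k)%N by rewrite expn_gt0.
rewrite [(3 ^ k.+1)%N in X in (_ %| X)%N]expnSr expnM.
have x3 : (3 %| 4 ^ 3 ^ k - 1)%N by apply: dvdn_trans IH; rewrite expnS dvdn_mulr.
move: (4 ^ 3 ^ k)%N x1 x3 IH => x x1 x3 IH.
have -> : (x ^ 3 - 1 = (x - 1) * (x ^ 2 + x + 1))%N.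
  by case: x x1 {x3 IH} => // x _; rewrite subn1 /= !expnS expn0; lia.
rewrite expnSr dvdn_mul //; move: x3 => /dvdnP[y xy].
have -> : x = (3 * y + 1)%N by lia.
by apply/dvdnP; exists (3 * y ^ 2 + 3 * y + 1)%N; rewrite !expnS expn0; lia.
Qed.

(** * A family of periodic points of growing height *)

Definition point (x y z : algC) : 'rV[algC]_3 := \row_(i < 3) [:: x; y; z]`_i.

Lemma fE x y z : f (point x y z) = point y (x + y - y ^+ 3) (2%:R * z - y).
Proof. by rewrite /f !mxE. Qed.

Lemma iter_f_orb t z n : iter n f (point 0 t z) =
  point (orb t n) (orb t n.+1) (2 ^+ n * z - \sum_(i < n.+1) 2 ^+ (n - i) * orb t i).
Proof.
elim: n => [|n IH]; first by rewrite big_ord1 expr0 mul1r mulr0 subr0.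
rewrite iterS IH fE; congr point.
rewrite [in RHS]big_ord_recr /= subnn expr0 mul1r mulrBr mulrA -exprS opprD addrA.
congr (_ - _ - _); rewrite mulr_sumr; apply: eq_bigr => i _.
by rewrite mulrA -exprS -subSn // -ltnS.
Qed.

(** When y_m(t) = 0, this is the numerator H of the third coordinate over the denominator 2^(2m) -
    1. *)
Definition denom_poly (A : comNzRingType) (t : A) m :=
  \sum_(i < m) (2 ^+ (m.*2 - i) - (-1) ^+ i * 2 ^+ i) * orb t i.

Lemma rmorph_denom_poly (A B : comNzRingType) (F : {rmorphism A -> B}) t m :
  F (denom_poly t m) = denom_poly (F t) m.
Proof.
rewrite rmorph_sum; apply: eq_bigr => i _.
by rewrite rmorphM rmorphB rmorphM !rmorphXn rmorphN rmorph1 rmorph_nat rmorph_orb.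
Qed.

Lemma periodic_point t m : orb t m = 0 -> ~~ odd m -> (0 < m)%N ->
  iter m.*2 f (point 0 t (denom_poly t m / (2 ^ m.*2 - 1)%N%:R)) =
  point 0 t (denom_poly t m / (2 ^ m.*2 - 1)%N%:R).
Proof.
move=> ym m_even m0; have [y2m y2m1] := orb_period ym m_even m0.
rewrite iter_f_orb y2m y2m1 orb_weighted_sum //; congr point.
have N0 : (2 ^ m.*2 - 1)%N%:R != 0 :> algC.
  rewrite pnatr_eq0 -lt0n subn_gt0 -{1}(expn0 2) ltn_exp2l //; lia.
rewrite -/(denom_poly t m); apply: (mulIf N0); rewrite mulrBl mulrA !divfK //.
rewrite natrB ?expn_gt0 // natrX; ring.
Qed.

(** Modulo 3 one has 2 = -1, so for even [n] the coefficient of the last term y_{n+1} is -1 - 1 = 1;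
    this term has degree 3^n and all earlier ones have smaller degree. *)
Lemma denom_polyX_size n : ~~ odd n ->
  size (denom_poly ('X : {poly 'F_3}) n.+2) = (3 ^ n).+1.
Proof.
move=> n_even; rewrite /denom_poly big_ord_recr /=.
have two : (2%:R : {poly 'F_3}) = -1.
  have c3 : (3%:R : {poly 'F_3}) = 0 by rewrite -(rmorph_nat polyC) pchar_Fp_0 // polyC0.
  by apply/eqP; rewrite -subr_eq0 opprK -[X in _ + X]/(1%:R) -natrD c3.
have -> : 2 ^+ (n.+2.*2 - n.+1) - (-1) ^+ n.+1 * 2 ^+ n.+1 = 1 :> {poly 'F_3}.
  have -> : (n.+2.*2 - n.+1 = n.+3)%N by lia.
  rewrite two -exprD -signr_odd -[in X in _ - X]signr_odd addnn odd_double /= negbK (negPf n_even).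
  by rewrite expr0 expr1 -opprD -[1 + 1]/(2%:R) two opprK.
rewrite mul1r addrC; have [szY _] := orb_polyX_size 'F_3 n.
rewrite size_polyDl ?szY // ltnS; apply: leq_trans (size_sum _ _ _) _.
apply/bigmax_leqP => i _.
have -> : 2 ^+ (n.+2.*2 - i) - (-1) ^+ i * 2 ^+ i =
    (2 ^+ (n.+2.*2 - i) - (-1) ^+ i * 2 ^+ i)%:P :> {poly 'F_3}.
  by rewrite rmorphB rmorphM !rmorphXn rmorphN rmorph1 rmorph_nat.
rewrite mul_polyC; apply: leq_trans (size_scale_leq _ _) _.
by apply: leq_trans (orb_polyX_size_le _ _) _; rewrite leq_pexp2l // -ltnS.
Qed.

Lemma separable_orb_polyX q : separable_poly (orb ('X : {poly 'F_3}) (4 * q).+2).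
Proof.
rewrite separable_poly.unlock deriv_orb_polyX3.
rewrite (@eqp_coprimepr _ _ _ 1) ?coprimep1 // -size_poly_eq1 -signr_odd.
by case: (odd q); rewrite ?size_polyN size_poly1.
Qed.

Lemma periodic_height (R : realType) (k : nat) :
  exists P : 'rV[algC]_3, (exists2 n, (1 <= n)%N & iter n f P = P) /\
    (2 * k.+1)%:R * ln 3%:R <= 3%:R * height R (affine_to_proj P).
Proof.
pose m := (2 * 3 ^ k)%N; pose N := (2 ^ m.*2 - 1)%N.
have k3 : (0 < 3 ^ k)%N by rewrite expn_gt0.
have m_even : ~~ odd m by rewrite /m oddM.
(* As 3^k is odd, m is 2 modulo 4, the shape of index at which the derivative modulo 3 is a sign. *)
have [q mq] : exists q, m = (4 * q).+2.
  exists (3 ^ k)./2; have : odd (3 ^ k) by rewrite oddX orbT.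
  rewrite /m; move: (3 ^ k)%N => x x_odd; have := odd_double_half x.
  by rewrite x_odd; lia.
have N0 : (0 < N)%N by rewrite /N subn_gt0 -{1}(expn0 2) ltn_exp2l //; lia.
have N3 : (3 ^ k.+1 %| N)%N.
  have -> : N = ((4 ^ 3 ^ k - 1) * (4 ^ 3 ^ k + 1))%N.
    rewrite /N; have -> : m.*2 = (2 * 3 ^ k * 2)%N by rewrite muln2.
    by rewrite expnM expnM -subn_sqr exp1n.
  by rewrite dvdn_mulr // dvdn_pow4.
(* The leading coefficient of y_m is (-1)^(m-1) = -1; the sign makes [G] monic. *)
pose G : {poly int} := - orb 'X m.
have [szY leadY] := orb_polyX_size int (4 * q).+1; rewrite -mq in szY leadY.
have Gm : G \is monic.
  by rewrite monicE lead_coefN leadY -signr_odd /= oddM /= expr1 opprK.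
have szG : size G = (3 ^ (4 * q).+1).+1 by rewrite size_polyN.
have redG : red 3 G = - orb 'X m by rewrite rmorphN /= red_orb.
pose H := denom_poly ('X : {poly int}) m.
have redH : red 3 H = denom_poly 'X m by rewrite rmorph_denom_poly /= /red map_polyX.
have szH : size (red 3 H) = (3 ^ (4 * q)).+1 by rewrite redH mq denom_polyX_size // oddM.
(* The constant 3 is the ratio of the degrees 3^(4q+1) of [G] and 3^(4q) of [H] modulo 3, the latter
   bounding the degree of the gcd. *)
have [|||g [gm g_irr gG g_sep g_gcd]] := @good_irreducible_factor 3 3 G (red 3 H) isT Gm.
- by rewrite szG ltnS expn_gt0.
- rewrite redG (@eqp_separable _ _ (orb 'X m)) -?scaleN1r ?eqp_scale ?oppr_eq0 ?oner_eq0 //.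
  by rewrite mq separable_orb_polyX.
- rewrite szG /= expnS leq_mul2l /=; apply: leq_trans (_ : (size (red 3 H)).-1 <= _)%N; last by rewrite szH.
  have H0 : red 3 H != 0 by rewrite -size_poly_gt0 szH.
  by rewrite -!subn1 leq_sub2r // dvdp_leq // dvdp_gcdr.
have G_dvd : exists r, G = g * r.
  by have /dvdpP_int[r] := gG; rewrite zprimitive_monic // => ->; exists r.
have g1 : (1 < size g)%N.
  by have := g_irr.1; rewrite size_map_inj_poly //; exact: intr_inj.
have /closed_rootP[t /rootP gt] : size (map_poly intr g : {poly algC}) != 1%N.
  by rewrite size_map_poly_id0 ?(monicP gm) ?oner_eq0 //; lia.
have evX (a : {poly int}) : (map_poly intr a : {poly algC}).[t] = (horner_eval t \o map_poly intr) a by [].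
have yt : orb t m = 0.
  have : (map_poly intr G : {poly algC}).[t] = 0.
    by have [r ->] := G_dvd; rewrite rmorphM hornerM gt mul0r.
  rewrite evX /G rmorphN rmorph_orb /= map_polyX /horner_eval hornerX.
  by move/eqP; rewrite oppr_eq0 => /eqP.
have Ht : (map_poly intr H : {poly algC}).[t] = denom_poly t m.
  by rewrite evX /H rmorph_denom_poly /= map_polyX /horner_eval hornerX.
have m0 : (0 < m)%N by rewrite /m; lia.
exists (point 0 t (denom_poly t m / N%:R)); split.
  by exists m.*2; [rewrite double_gt0 | exact: periodic_point].
rewrite /height; case: num_field_exists => K [QC [s1 s1E genK]].
set x := affine_to_proj _ in s1E.
have xE (i : 'I_4) : x 0 i = [:: 1; 0; t; denom_poly t m / N%:R]`_i.
  rewrite /x /affine_to_proj (mxE _ _ _ i) /=; case: (@splitP 1 3 i) => j ij; rewrite !mxE ij //.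
  by rewrite ord1.
have s1_sz : size s1 = 4.
  by have := congr1 size s1E; rewrite 2!size_map size_enum_ord.
have s1i (i : 'I_4) : QC s1`_i = x 0 i.
  have := congr1 (fun s : seq algC => s`_i) s1E.
  by rewrite (nth_map 0) ?s1_sz // (nth_map ord0) ?size_enum_ord // nth_ord_enum.
have NK : N%:R != 0 :> K by rewrite -(rmorph_nat (in_alg K)) fmorph_eq0 pnatr_eq0 -lt0n.
have NC : N%:R != 0 :> algC by rewrite pnatr_eq0 -lt0n.
pose theta := s1`_2.
have evQ (b : {poly int}) : QC (int_eval theta b) = (map_poly intr b : {poly algC}).[t].
  have <- : QC theta = t by rewrite (s1i (@Ordinal 4 2 isT)) xE.
  rewrite /int_eval /horner_eval -horner_map -map_poly_comp; congr _.[_].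
  by apply: eq_map_poly => z /=; rewrite rmorph_int.
have g_root : int_eval theta g = 0 by apply: (fmorph_inj QC); rewrite evQ gt rmorph0.
(* Numerators of the homogeneous coordinates 1, 0, t, z over the common denominator [N]. *)
pose a (i : 'I_4) : {poly int} := [:: N%:R; 0; N%:R * 'X; H]`_i.
have uN (i : 'I_4) : s1`_i * N%:R = int_eval theta (a i).
  apply: (fmorph_inj QC); rewrite rmorphM s1i xE evQ rmorph_nat /a.
  case: i => [[|[|[|[|//]]]] ?] /=.
  - by rewrite mul1r rmorph_nat hornerMn hornerC.
  - by rewrite mul0r rmorph0 horner0.
  - by rewrite rmorphM rmorph_nat /= map_polyX mulr_natl hornerMn hornerX mulr_natr.
  - by rewrite Ht divfK.
(* [K] is generated by the four coordinates, each of which is a rational polynomial in [theta]. *)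
have theta_gen : <<1; (theta : K)>>%VS = fullv.
  apply/eqP; rewrite eqEsubv subvf /= -genK; apply/Fadjoin_seqP; split; first exact: sub1v.
  move=> y ys; have [i i4 <-] := nthP (0 : K) ys; rewrite s1_sz in i4.
  have -> : s1`_i = int_eval theta (a (Ordinal i4)) / N%:R by rewrite -uN mulfK.
  rewrite rpred_div ?rpred_nat // int_eval_rat; apply: mempx_Fadjoin; exact: alg_polyOver.
apply: (@number_field_height_factor R 3 K theta g isT theta_gen gm g_irr g_sep g_root
  3 N k.+1 3 _ a (@Ordinal 4 3 isT)) => //.
- by rewrite mxE; apply: (fmorph_inj QC); rewrite (s1i ord0) xE rmorph1.
- by move=> i; rewrite mxE uN.

Qed.

(** * Finiteness of the periodic points *)

Lemma finite_roots (F : idomainType) (q : {poly F}) : q != 0 -> finite_set [set x | root q x].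
Proof.
move=> q0; apply: contrapT => /(infinite_set_fset (size q))[B BP].
apply/negP; rewrite -ltnNge; apply: max_poly_roots (fset_uniq B) => //.
by apply/allP => x; exact: BP.
Qed.

(* The monomials with exponents at most 2 span an algebra in which every [y i]
   acts by a matrix independent of the solution. *)
Section CubicSystem.
Variables (F : fieldType) (I : finType) (L : I -> I -> F).

Definition cubic_solution (y : I -> F) := forall i, y i ^+ 3 = \sum_j L i j * y j.

Definition monom (y : I -> F) (e : {ffun I -> nat}) := \prod_i y i ^+ e i.

Let reduced := {ffun I -> 'I_3}.
Let embed (r : reduced) : {ffun I -> nat} := [ffun i => r i : nat].

Let add_var (e : {ffun I -> nat}) i : {ffun I -> nat} := [ffun j => e j + (j == i)]%N.

Let monom_add_var y e i : monom y (add_var e i) = y i * monom y e.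
Proof.
rewrite /monom (eq_bigr (fun j => y j ^+ (j == i) * y j ^+ e j)); last first.
  by move=> j _; rewrite ffunE addnC exprD.
rewrite big_split /= (bigD1 i) //= eqxx expr1 big1 ?mulr1 // => j /negPf->.
by rewrite expr0.
Qed.

(** Induction on the total degree: replacing a cube by a linear form lowers it by 2. The
    coefficients [c] are chosen before [y]. *)
Lemma monom_reduce e : exists c : reduced -> F,
  forall y, cubic_solution y -> monom y e = \sum_r c r * monom y (embed r).
Proof.
have [d] := ubnP (\sum_i e i)%N; elim: d e => // d IH e /ltnSE sum_e.
have [/existsP[i i3]|/existsPn small] := boolP [exists i, (3 <= e i)%N]; last first.
  pose r0 : reduced := [ffun i => inord (e i)].
  exists (fun r => (r == r0)%:R) => y _.
  rewrite (bigD1 r0) //= eqxx mul1r big1 ?addr0 => [|r /negPf->]; last by rewrite mul0r.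
  by apply: eq_bigr => i _; rewrite !ffunE inordK // ltnNge small.
pose e' : {ffun I -> nat} := [ffun j => if j == i then e i - 3 else e j]%N.
have eE : e = add_var (add_var (add_var e' i) i) i.
  by apply/ffunP => j; rewrite !ffunE; case: eqP => [->|_]; lia.
have /fin_all_exists[c cP] j : exists c : reduced -> F, forall y, cubic_solution y ->
    monom y (add_var e' j) = \sum_r c r * monom y (embed r).
  apply: IH; apply: leq_trans sum_e; rewrite eE.
  have sum_add k (e1 : {ffun I -> nat}) : (\sum_l add_var e1 k l = (\sum_l e1 l).+1)%N.
    under eq_bigr do rewrite ffunE.
    rewrite big_split /= (_ : \sum_l (l == k) = 1)%N ?addn1 //.
    by rewrite (bigD1 k) //= eqxx big1 // => l /negbTE ->.
  by rewrite !sum_add; lia.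
exists (fun r => \sum_j L i j * c j r) => y yP.
have -> : monom y e = y i ^+ 3 * monom y e'.
  by rewrite eE !monom_add_var; ring.
rewrite yP mulr_suml; under [RHS]eq_bigr do rewrite mulr_suml.
rewrite exchange_big /=; apply: eq_bigr => j _.
rewrite -mulrA -monom_add_var cP // mulr_sumr; apply: eq_bigr => r _; exact: mulrA.
Qed.

(** The vector of reduced monomials is an eigenvector with eigenvalue [y i] of a fixed matrix [M],
    nonzero because the empty monomial is 1. So [y i] is a root of the characteristic polynomial. *)
Lemma finite_cubic_coord i : finite_set [set y i | y in cubic_solution].
Proof.
have /fin_all_exists[c cP] (r : reduced) := monom_reduce (add_var (embed r) i).
pose M : 'M[F]_#|{: reduced}| := \matrix_(s, r) c (enum_val r) (enum_val s).
apply: (sub_finite_set _ (finite_roots (monic_neq0 (char_poly_monic M)))) => _ [y yP <-] /=.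
rewrite -eigenvalue_root_char; apply/eigenvalueP.
exists (\row_r monom y (embed (enum_val r))).
  apply/rowP => r; rewrite !mxE -monom_add_var cP //.
  rewrite [RHS](reindex_onto enum_val enum_rank) /=; last by move=> s _; exact: enum_rankK.
  apply: eq_big => [s|s _]; first by rewrite enum_valK eqxx.
  by rewrite !mxE mulrC.
apply/eqP => /rowP/(_ (enum_rank [ffun=> ord0])); rewrite !mxE enum_rankK /monom.
by rewrite big1 => [/eqP|j _]; rewrite ?oner_eq0 // !ffunE expr0.
Qed.

End CubicSystem.

Lemma f_coord0 P : f P 0 0 = P 0 1. Proof. by rewrite mxE. Qed.

Lemma f_coord1 P : f P 0 1 = P 0 0 + P 0 1 - P 0 1 ^+ 3. Proof. by rewrite mxE. Qed.

Lemma f_coord2 P : f P 0 2%:R = 2%:R * P 0 2%:R - P 0 1. Proof. by rewrite mxE. Qed.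

(** The second coordinate of a point is the first coordinate of its image, so along a periodic orbit
    the first coordinates solve a cyclic cubic system. *)
Lemma finite_periodic_coord0 n : finite_set [set P 0 0 | P in [set P | iter n.+1 f P = P]].
Proof.
pose L (i j : 'I_n.+1) : algC := (j == ord_pred i)%:R + (j == i)%:R - (j == ordS i)%:R.
apply: (sub_finite_set _ (finite_cubic_coord L ord0)) => _ [P PP <-].
have {}PP : iter n.+1 f P = P := PP.
exists (fun i : 'I_n.+1 => iter i f P 0 0) => //= i.
have mod_iter k : iter (k %% n.+1) f P = iter k f P.
  rewrite {2}(divn_eq k n.+1) addnC iterD; congr (iter _ _ _).
  by elim: (k %/ n.+1)%N => // l IH; rewrite mulSn iterD -IH PP.
have -> : \sum_j L i j * iter j f P 0 0 =
    iter (ord_pred i) f P 0 0 + iter i f P 0 0 - iter (ordS i) f P 0 0.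
  have delta (k : 'I_n.+1) : \sum_j (j == k)%:R * iter j f P 0 0 = iter k f P 0 0.
    rewrite (bigD1 k) //= eqxx mul1r big1 ?addr0 // => j /negPf->.
    by rewrite mul0r.
  rewrite -!delta -big_split -sumrB /=; apply: eq_bigr => j _.
  by rewrite /L; ring.
(* The index is shifted by one period so that the predecessor of [i = 0] is also an iterate. *)
rewrite /= !mod_iter -(mod_iter i) -(modnDr i) mod_iter.
have -> : iter i.+1 f P = iter (i + n.+1).+1 f P.
  by rewrite -(mod_iter (i + n.+1).+1) -addSn modnDr mod_iter.
rewrite addnS /= !f_coord0 f_coord1; ring.
Qed.

(** The first two coordinates are first coordinates of the periodic points [P] and [f P], so they
    range over a finite set. They determine the third, as the difference of two third coordinates
    doubles at each step and 2^n is not 1. *)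
Lemma finite_periodic n : (1 <= n)%N -> finite_set [set P | iter n f P = P].
Proof.
case: n => // n _; have fin := finite_periodic_coord0 n.
pose Q (xy : algC * algC) := [set P | [/\ iter n.+1 f P = P, P 0 0 = xy.1 & P 0 1 = xy.2]].
apply: (sub_finite_set _ (finite_image (xget 0 \o Q) (finite_setX fin fin))) => P PP.
have {}PP : iter n.+1 f P = P := PP.
exists (P 0 0, P 0 1).
  split=> /=; first by exists P.
  by exists (f P); rewrite /= ?f_coord0 // -iterSr -[in RHS]PP.
rewrite /= ; apply: xget_unique; first by [].
move=> P' [P'P' /= x y].
have E k : [/\ iter k f P' 0 0 = iter k f P 0 0, iter k f P' 0 1 = iter k f P 0 1 &
    iter k f P' 0 2%:R - iter k f P 0 2%:R = 2%:R ^+ k * (P' 0 2%:R - P 0 2%:R)].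
  elim: k => [|k [e0 e1 e2]]; first by rewrite mul1r.
  rewrite !iterS !f_coord0 !f_coord1 !f_coord2 e0 e1; split=> //.
  by rewrite exprS -mulrA -e2; ring.
have ne0 : 1 - 2%:R ^+ n.+1 != 0 :> algC.
  by rewrite subr_eq0 -natrX (eqr_nat _ 1) -[X in X == _](expn0 2) eqn_exp2l.
have z : P' 0 2%:R = P 0 2%:R.
  have [_ _] := E n.+1; rewrite P'P' PP => /eqP.
  rewrite -[X in X == _]mul1r -subr_eq0 -mulrBl mulf_eq0 (negPf ne0) /= subr_eq0.
  by move/eqP.
apply/rowP => i; case: i => [[|[|[|//]]] p].
- by rewrite (_ : Ordinal p = 0) //; exact/val_inj.
- by rewrite (_ : Ordinal p = 1) //; exact/val_inj.
- by rewrite (_ : Ordinal p = 2%:R) //; exact/val_inj.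
Qed.

Theorem theorem1p3 (R : realType) :
  (forall n : nat, (1 <= n)%N ->
     finite_set [set P : 'rV[algC]_3 | iter n f P = P]) /\
  ~ height_bounded R
      [set P : 'rV[algC]_3 | exists2 n : nat, (1 <= n)%N & iter n f P = P].
Proof.
split; first exact: finite_periodic.
move=> [M MP]; have ln3 : 0 < ln 3%:R :> R by rewrite ln_gt0 // ltr1n.
(* This [k] is at least 3 M / log 3, which contradicts 2 (k + 1) log 3 <= 3 M; the absolute value
   covers a negative ceiling. *)
pose k := `|Num.ceil (3%:R * M / ln 3%:R)|%N.
have [P [Pper Ph]] := periodic_height R k.
have : 3%:R * height R (affine_to_proj P) <= 3%:R * M.
  by rewrite ler_pM2l ?ltr0n // (le_trans (ler_norm _) (MP P Pper)).
move/(le_trans Ph); rewrite -ler_pdivlMr //; apply/negP; rewrite -ltNge.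
apply: le_lt_trans (ceil_ge _) _; apply: (@le_lt_trans _ _ k%:R).
  by rewrite /k -[leRHS]/((Posz `|_|%N)%:~R) ler_int abszE ler_norm.
by rewrite ltr_nat; lia.
Qed.
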